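(* Let $(\omega_1,\omega_2,\omega_3)$ be a triplet of $2$-forms and $(\pi_1,\pi_2,\pi_3)$ a triplet of bivectors on a Lie algebroid $(A,\mu)$, and let $$\mathcal{S}_i=\begin{pmatrix}0&-\pi_i^{\sharp}\\ \omega_i^{\flat}&0\end{pmatrix}:A\oplus A^*\to A\oplus A^*,\qquad i=1,2,3 .$$ The following assertions are equivalent: (i) $(\omega_1,\omega_2,\omega_3)$ is a hypersymplectic structure with torsion on the Lie algebroid $(A,\mu)$, $\pi_i$ is the inverse of $\omega_i$ and $\pi_i$ is weak-Poisson, $i=1,2,3$; (ii) $(\mathcal{S}_1,\mathcal{S}_2,\mathcal{S}_3)$ is a hypersymplectic structure on the Courant algebroid $(A\oplus A^*,\mu+\psi)$, for some $\psi\in\Gamma(\wedge^3A)$ (in particular, $\mu+\psi$ is a Courant structure).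
   Context: $A\to M$ is a real vector bundle. For $\omega\in\Gamma(\wedge^2A^* )$ and $\pi\in\Gamma(\wedge^2A)$, $\omega^\flat:A\to A^*$, $\langle\omega^\flat X,Y\rangle=\omega(X,Y)$, and $\pi^\sharp:A^*\to A$, $\langle\beta,\pi^\sharp\alpha\rangle=\pi(\alpha,\beta)$; $\pi$ is the inverse of $\omega$ if $\pi^\sharp\circ\omega^\flat=\mathrm{id}_A$. Indices are in $\mathbb{Z}_3=\{1,2,3\}$. Hypersymplectic with torsion: a triplet $(\omega_1,\omega_2,\omega_3)$ of non-degenerate $2$-forms on $(A,\mu)$ with inverses $\pi_1,\pi_2,\pi_3\in\Gamma(\wedge^2A)$ is a hypersymplectic structure with torsion on $(A,\mu)$ if the transition morphisms $N_i:=\pi_{i-1}^\sharp\circ\omega_{i+1}^\flat:A\to A$ satisfy $N_i^2=-\mathrm{id}_A$, $i=1,2,3$, and $N_1\mathrm{d}\omega_1=N_2\mathrm{d}\omega_2=N_3\mathrm{d}\omega_3$, where $N_i\mathrm{d}\omega_i(X,Y,Z)=\mathrm{d}\omega_i(N_iX,N_iY,N_iZ)$ and $\mathrm{d}$ is the differential of the Lie algebroid $(A,\mu)$. Big bracket: $\mathcal{F}=C^\infty(T^*[2]A[1])$ with its canonical Poisson bracket $\{\cdot,\cdot\}$ (the big bracket), given in local coordinates $x_i,\xi_a$ on $A[1]$ and conjugate $p^i,\theta^a$ by $\{p^i,x_i\}=\{\theta^a,\xi_a\}=1$, other brackets zero. Bidegrees: $x_i:(0,0)$, $\xi_a:(0,1)$,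 $p^i:(1,1)$, $\theta^a:(1,0)$; $\mathcal{F}^{k,l}$ is the space of functions of bidegree $(k,l)$, $\mathcal{F}^{k,0}=\Gamma(\wedge^kA)$, $\mathcal{F}^{0,l}=\Gamma(\wedge^lA^* )$. A Lie algebroid structure on $A$ is an element $\mu\in\mathcal{F}^{1,2}$ with $\{\mu,\mu\}=0$ (bracket $\{\{X,\mu\},Y\}$, anchor $\rho(X)\cdot f=\{\{X,\mu\},f\}$). A bivector $\pi$ on $(A,\mu)$ is weak-Poisson if $\{\mu,\{\{\pi,\mu\},\pi\}\}=0$, equivalently $\{\mu,[\pi,\pi]\}=0$ with $[\cdot,\cdot]$ the Schouten–Nijenhuis bracket. $A\oplus A^*$ carries $\langle X+\alpha,Y+\beta\rangle=\alpha(Y)+\beta(X)$. Any $\Theta$ of total degree $3$ in $\mathcal{F}$ defines a pre-Courant structure on $A\oplus A^*$, with anchor $\rho(e)\cdot f=\{\{e,\Theta\},f\}$ and Dorfman bracket $[e,e']=\{\{e,\Theta\},e'\}$ (pre-Courant means $\rho(e)\cdot\langle e',e''\rangle=\langle[e,e'],e''\rangle+\langle e',[e,e'']\rangle=\langle e,[e',e'']+[e'',e']\rangle$). It is a Courant structure if the Dorfman bracket satisfies $[e,[e',e'']]=[[e,e'],e'']+[e',[e,e'']]$, equivalently $\{\Theta,\Theta\}=0$. For a pre-Courant structure $\Theta=(\rho,[\cdot,\cdot])$ on $E$ and a bundle endomorphism $\mathcal{I}$ of $E$, $\Theta_{\mathcal{I}}=(\rho\circ\mathcal{I},[\cdot,\cdot]_{\mathcal{I}})$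 with $[e,e']_{\mathcal{I}}=[\mathcal{I}e,e']+[e,\mathcal{I}e']-\mathcal{I}[e,e']$, and $\Theta_{\mathcal{I},\mathcal{J}}=(\Theta_{\mathcal{I}})_{\mathcal{J}}$. A hypersymplectic structure on $(E,\Theta)$ is a triplet $(\mathcal{S}_1,\mathcal{S}_2,\mathcal{S}_3)$ of endomorphisms of $E$, skew-symmetric with respect to $\langle\cdot,\cdot\rangle$, such that $\mathcal{S}_i^2=-\mathrm{id}_E$, $\mathcal{S}_i\mathcal{S}_j=-\mathcal{S}_j\mathcal{S}_i$ for $i\neq j$, and $\Theta_{\mathcal{S}_i,\mathcal{S}_i}=-\Theta$, for $i,j\in\{1,2,3\}$. *)

(* Defs.v *)
From HB Require Import structures.
From mathcomp Require Import all_boot all_algebra.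
From mathcomp Require Import ring.
From mathcomp Require Import all_classical all_reals all_analysis.
Import numFieldNormedType.Exports.
Set Implicit Arguments.
Unset Strict Implicit.
Unset Printing Implicit Defensive.
Import GRing.Theory.
Local Open Scope classical_set_scope.
Local Open Scope ring_scope.

Section SmoothEuclidean.
Variables (R : realType) (n : nat).
Implicit Types (V : set 'rV[R]_n) (f g : 'rV[R]_n -> R).

Definition is_partial (i : 'I_n) V f g :=
  forall x, V x ->
    is_derive (0 : R) (1 : R) (fun t : R => f (x + t *: delta_mx 0 i)) (g x).

(* Class C^k on V; only meant for V open.  The partial derivatives are those of
   one-variable functions, so that n = 0 is allowed. *)
Fixpoint Ck (k : nat) V f : Prop :=
  (forall x, V x -> {for x, continuous f}) /\
  match k with
  | 0 => True
  | k'.+1 => forall i, exists2 g, is_partial i V f g & Ck k' V g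
  end.

Definition Cinfty V f := forall k, Ck k V f.

Lemma CkS k V f : Ck k.+1 V f -> Ck k V f.
Proof.
elim: k f => [|k IH] f [cf df]; split=> // i.
by have [g fg /IH] := df i; exists g.
Qed.

Lemma Ck_cst k V (c : R) : Ck k V (fun=> c).
Proof.
elim: k c => [|k IH] c; split; try (by move=> x _; apply: cst_continuous).
  by [].
by move=> i; exists (fun=> 0) => [x _|]; [exact: is_derive_cst|exact: IH].
Qed.

Lemma CkD k V f g : Ck k V f -> Ck k V g -> Ck k V (fun x => f x + g x).
Proof.
elim: k f g => [|k IH] f g [cf df] [cg dg]; split;
  try (by move=> x Vx; exact: (cvgD (cf x Vx) (cg x Vx))).
  by [].
move=> i; have [f' ff' Cf] := df i; have [g' gg' Cg] := dg i.
exists (fun x => f' x + g' x) => [x Vx|]; last exact: IH.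
by have F := ff' x Vx; have G := gg' x Vx; exact: is_deriveD.
Qed.

Lemma CkM k V f g : Ck k V f -> Ck k V g -> Ck k V (fun x => f x * g x).
Proof.
elim: k f g => [|k IH] f g Cf Cg; have [cf df] := Cf; have [cg dg] := Cg; split;
  try (by move=> x Vx; exact: (cvgM (cf x Vx) (cg x Vx))).
  by [].
move=> i; have [f' ff' Cf'] := df i; have [g' gg' Cg'] := dg i.
exists (fun x => f x * g' x + g x * f' x) => [x Vx|].
  have F := ff' x Vx; have G := gg' x Vx.
  apply: (is_derive_eq (is_deriveM F G)).
  by rewrite scale0r !addr0.
by apply: CkD; apply: IH => //; apply: CkS.
Qed.

Lemma CkN k V f : Ck k V f -> Ck k V (fun x => - f x).
Proof.
move=> /(CkM (Ck_cst k V (-1))); congr Ck.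
by apply/funext => x; rewrite mulN1r.
Qed.

End SmoothEuclidean.

Record chart (R : realType) (M : topologicalType) (n : nat) := Chart {
  chart_dom : set M;
  chart_cod : set 'rV[R]_n;
  chart_map : M -> 'rV[R]_n;
  chart_inv : 'rV[R]_n -> M;
  chart_dom_open : open chart_dom;
  chart_cod_open : open chart_cod;
  chart_mapP : forall p, chart_dom p -> chart_cod (chart_map p);
  chart_invP : forall x, chart_cod x -> chart_dom (chart_inv x);
  chart_mapK : forall p, chart_dom p -> chart_inv (chart_map p) = p;
  chart_invK : forall x, chart_cod x -> chart_map (chart_inv x) = x;
  chart_map_continuous : forall p, chart_dom p -> {for p, continuous chart_map};
  chart_inv_continuous : forall x, chart_cod x -> {for x, continuous chart_inv}
}.

Definition compatible_charts (R : realType) (M : topologicalType) (n : nat)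
    (c d : chart R M n) :=
  forall j : 'I_n,
    Cinfty (chart_cod c `&` chart_inv c @^-1` chart_dom d)
           (fun x => chart_map d (chart_inv c x) 0 j).

Record manifold (R : realType) (n : nat) := Manifold {
  carrier :> topologicalType;
  manifold_hausdorff : hausdorff_space carrier;
  manifold_second_countable : @second_countable carrier;
  atlas : set (chart R carrier n);
  atlas_cover : forall p, exists2 c, atlas c & chart_dom c p;
  atlas_compatible : forall c d, atlas c -> atlas d -> compatible_charts c d
}.
Arguments atlas {R n} m.

Section SmoothFunctions.
Variables (R : realType) (n : nat) (M : manifold R n).

Definition smooth_on (W : set M) (f : M -> R) :=
  forall c, atlas M c ->
    Cinfty (chart_cod c `&` chart_inv c @^-1` W) (fun x => f (chart_inv c x)).

Lemma smooth_on_cst W (a : R) : smooth_on W (fun=> a).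
Proof. by move=> c _ k; exact: Ck_cst. Qed.
Lemma smooth_onD W f g :
  smooth_on W f -> smooth_on W g -> smooth_on W (fun p => f p + g p).
Proof. by move=> sf sg c Mc k; apply: CkD; [exact: sf|exact: sg]. Qed.
Lemma smooth_onM W f g :
  smooth_on W f -> smooth_on W g -> smooth_on W (fun p => f p * g p).
Proof. by move=> sf sg c Mc k; apply: CkM; [exact: sf|exact: sg]. Qed.
Lemma smooth_onN W f : smooth_on W f -> smooth_on W (fun p => - f p).
Proof. by move=> sf c Mc k; apply: CkN; exact: sf. Qed.

Lemma smooth_on_sub (W W' : set M) f :
  W' `<=` W -> smooth_on W f -> smooth_on W' f.
Proof.
have sub k V V' (g : 'rV[R]_n -> R) : V' `<=` V -> Ck k V g -> Ck k V' g.
  move=> VV'; elim: k g => [|k IH] g [cg dg]; split=> //;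
    try (by move=> x /VV'; exact: cg).
  move=> i; have [h gh Ch] := dg i.
  by exists h; [move=> x /VV'; exact: gh|exact: IH].
move=> WW' sf c Mc k; apply: sub (sf c Mc k).
by apply: setIS => x /WW'.
Qed.

Record smooth_fun := SmoothFun {
  sfun :> M -> R;
  sfunP : smooth_on setT sfun
}.

Lemma smooth_fun_eq (f g : smooth_fun) : (forall p, f p = g p) -> f = g.
Proof.
case: f g => [f sf] [g sg] /= /funext fg; move: sg; rewrite -fg => sg.
by rewrite (Prop_irrelevance sf sg).
Qed.

HB.instance Definition _ := gen_eqMixin smooth_fun.
HB.instance Definition _ := gen_choiceMixin smooth_fun.

Definition scst (a : R) : smooth_fun := SmoothFun (smooth_on_cst setT a).
Definition sadd (f g : smooth_fun) : smooth_fun :=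
  SmoothFun (smooth_onD (sfunP f) (sfunP g)).
Definition smul (f g : smooth_fun) : smooth_fun :=
  SmoothFun (smooth_onM (sfunP f) (sfunP g)).
Definition sopp (f : smooth_fun) : smooth_fun :=
  SmoothFun (smooth_onN (sfunP f)).

Fact saddA : associative sadd.
Proof. by move=> f g h; apply: smooth_fun_eq => p /=; rewrite addrA. Qed.
Fact saddC : commutative sadd.
Proof. by move=> f g; apply: smooth_fun_eq => p /=; rewrite addrC. Qed.
Fact sadd0 : left_id (scst 0) sadd.
Proof. by move=> f; apply: smooth_fun_eq => p /=; rewrite add0r. Qed.
Fact saddN : left_inverse (scst 0) sopp sadd.
Proof. by move=> f; apply: smooth_fun_eq => p /=; rewrite addNr. Qed.
HB.instance Definition _ :=
  GRing.isZmodule.Build smooth_fun saddA saddC sadd0 saddN.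

Fact smulA : associative smul.
Proof. by move=> f g h; apply: smooth_fun_eq => p /=; rewrite mulrA. Qed.
Fact smulC : commutative smul.
Proof. by move=> f g; apply: smooth_fun_eq => p /=; rewrite mulrC. Qed.
Fact smul1 : left_id (scst 1) smul.
Proof. by move=> f; apply: smooth_fun_eq => p /=; rewrite mul1r. Qed.
Fact smulD : left_distributive smul +%R.
Proof. by move=> f g h; apply: smooth_fun_eq => p /=; rewrite mulrDl. Qed.
HB.instance Definition _ :=
  GRing.Zmodule_isComPzRing.Build smooth_fun smulA smulC smul1 smulD.

End SmoothFunctions.

Record local_triv (R : realType) (M : topologicalType) (fibre : M -> lmodType R)
    (r : nat) := LocalTriv {
  triv_dom : set M;
  triv_map : forall p, {linear fibre p -> 'rV[R]_r};
  triv_dom_open : open triv_dom;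
  triv_bij : forall p, triv_dom p -> bijective (triv_map p)
}.

Definition compatible_trivs (R : realType) (n : nat) (M : manifold R n)
    (fibre : M -> lmodType R) (r : nat) (t u : local_triv fibre r) :=
  exists g : M -> 'M[R]_r,
    (forall i j, smooth_on (triv_dom t `&` triv_dom u) (fun p => g p i j)) /\
    (forall p (v : fibre p), triv_dom t p -> triv_dom u p ->
       triv_map u p v = triv_map t p v *m g p).

Record vbundle (R : realType) (n : nat) (M : manifold R n) (r : nat) := VBundle {
  fibre : M -> lmodType R;
  trivs : set (local_triv fibre r);
  trivs_cover : forall p, exists2 t, trivs t & triv_dom t p;
  trivs_compatible : forall t u, trivs t -> trivs u -> compatible_trivs t u
}.
Arguments fibre {R n M r} v p.
Arguments trivs {R n M r} v.

Section Sections.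
Variables (R : realType) (n : nat) (M : manifold R n) (r : nat).
Variable A : vbundle M r.

Definition smooth_section (s : forall p, fibre A p) :=
  forall t, trivs A t ->
    forall j, smooth_on (triv_dom t) (fun p => triv_map t p (s p) 0 j).

Record gsection := GSection {
  gsec :> forall p, fibre A p;
  gsecP : smooth_section gsec
}.

Lemma gsection_eq (s t : gsection) : (forall p, s p = t p) -> s = t.
Proof.
case: s t => [s hs] [t ht] /= st.
have {}st : s = t by exact: functional_extensionality_dep.
by case: _ / st ht => ht; rewrite (Prop_irrelevance hs ht).
Qed.

HB.instance Definition _ := gen_eqMixin gsection.
HB.instance Definition _ := gen_choiceMixin gsection.

Fact gzeroP : smooth_section (fun=> 0).
Proof.
move=> t At j; rewrite (_ : (fun _ => _) = fun=> 0); first exact: smooth_on_cst.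
by apply/funext => p; rewrite linear0 mxE.
Qed.
Fact gaddP (s t : gsection) : smooth_section (fun p => s p + t p).
Proof.
move=> u Au j.
rewrite (_ : (fun _ => _) =
  fun p => triv_map u p (s p) 0 j + triv_map u p (t p) 0 j).
  by apply: smooth_onD; exact: gsecP.
by apply/funext => p; rewrite linearD mxE.
Qed.
Fact gscaleP (f : smooth_fun M) (s : gsection) :
  smooth_section (fun p => f p *: s p).
Proof.
move=> u Au j.
rewrite (_ : (fun _ => _) = fun p => f p * triv_map u p (s p) 0 j).
  apply: smooth_onM; last exact: gsecP.
  exact: smooth_on_sub (sfunP f).
by apply/funext => p; rewrite linearZ mxE.
Qed.

Definition gzero : gsection := GSection gzeroP.
Definition gadd (s t : gsection) : gsection := GSection (gaddP s t).
Definition gscale (f : smooth_fun M) (s : gsection) : gsection :=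
  GSection (gscaleP f s).
Definition gopp : gsection -> gsection := gscale (scst M (-1)).

Fact gaddA : associative gadd.
Proof. by move=> s t u; apply: gsection_eq => p /=; rewrite addrA. Qed.
Fact gaddC : commutative gadd.
Proof. by move=> s t; apply: gsection_eq => p /=; rewrite addrC. Qed.
Fact gadd0 : left_id gzero gadd.
Proof. by move=> s; apply: gsection_eq => p /=; rewrite add0r. Qed.
Fact gaddN : left_inverse gzero gopp gadd.
Proof. by move=> s; apply: gsection_eq => p /=; rewrite scaleN1r addNr. Qed.
HB.instance Definition _ :=
  GRing.isZmodule.Build gsection gaddA gaddC gadd0 gaddN.

Fact gscaleA f g s : gscale f (gscale g s) = gscale (f * g) s.
Proof. by apply: gsection_eq => p /=; rewrite scalerA. Qed.
Fact gscale1 : left_id 1 gscale.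
Proof. by move=> s; apply: gsection_eq => p /=; rewrite scale1r. Qed.
Fact gscaleDr : right_distributive gscale +%R.
Proof. by move=> f s t; apply: gsection_eq => p /=; rewrite scalerDr. Qed.
Fact gscaleDl s : {morph gscale^~ s : f g / f + g}.
Proof. by move=> f g; apply: gsection_eq => p /=; rewrite scalerDl. Qed.
HB.instance Definition _ := GRing.Zmodule_isLmodule.Build (smooth_fun M)
  gsection gscaleA gscale1 gscaleDr gscaleDl.

End Sections.

Section Dual.
Variables (C : comPzRingType) (V : lmodType C).

Record dual := Dual {
  dual_fun :> V -> C;
  dual_linear : forall f X Y, dual_fun (f *: X + Y) = f * dual_fun X + dual_fun Y
}.

Lemma dual_eq (a b : dual) : (forall X, a X = b X) -> a = b.
Proof.
case: a b => [a ha] [b hb] /= /funext ab.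
by move: hb; rewrite -ab => hb; rewrite (Prop_irrelevance ha hb).
Qed.

HB.instance Definition _ := gen_eqMixin dual.
HB.instance Definition _ := gen_choiceMixin dual.

Fact dual0P f (X Y : V) : (0 : C) = f * 0 + 0.
Proof. by rewrite mulr0 addr0. Qed.
Fact dualDP (a b : dual) f X Y :
  a (f *: X + Y) + b (f *: X + Y) = f * (a X + b X) + (a Y + b Y).
Proof. by rewrite !dual_linear mulrDr addrACA. Qed.
Fact dualZP g (a : dual) f X Y : g * a (f *: X + Y) = f * (g * a X) + g * a Y.
Proof. by rewrite dual_linear mulrDr mulrCA. Qed.

Definition dzero : dual := Dual dual0P.
Definition dadd (a b : dual) : dual := Dual (dualDP a b).
Definition dscale g (a : dual) : dual := Dual (dualZP g a).
Definition dopp : dual -> dual := dscale (-1).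

Fact daddA : associative dadd.
Proof. by move=> a b c; apply: dual_eq => X /=; rewrite addrA. Qed.
Fact daddC : commutative dadd.
Proof. by move=> a b; apply: dual_eq => X /=; rewrite addrC. Qed.
Fact dadd0 : left_id dzero dadd.
Proof. by move=> a; apply: dual_eq => X /=; rewrite add0r. Qed.
Fact daddN : left_inverse dzero dopp dadd.
Proof. by move=> a; apply: dual_eq => X /=; rewrite mulN1r addNr. Qed.
HB.instance Definition _ := GRing.isZmodule.Build dual daddA daddC dadd0 daddN.

Fact dscaleA f g a : dscale f (dscale g a) = dscale (f * g) a.
Proof. by apply: dual_eq => X /=; rewrite mulrA. Qed.
Fact dscale1 : left_id 1 dscale.
Proof. by move=> a; apply: dual_eq => X /=; rewrite mul1r. Qed.
Fact dscaleDr : right_distributive dscale +%R.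
Proof. by move=> f a b; apply: dual_eq => X /=; rewrite mulrDr. Qed.
Fact dscaleDl a : {morph dscale^~ a : f g / f + g}.
Proof. by move=> f g; apply: dual_eq => X /=; rewrite mulrDl. Qed.
HB.instance Definition _ :=
  GRing.Zmodule_isLmodule.Build C dual dscaleA dscale1 dscaleDr dscaleDl.

End Dual.

(* [C] stands for C^\infty(M), [E] for the sections of A (+) A^*, with its
   pairing.  The functions on T^*[2]A[1] of degree 0 and 1 are C and E; a
   function phi of degree n >= 2 is determined by its brackets {phi, f} and
   {phi, e} with these, and is represented by the pair of maps
   (f |-> {phi, f}, e |-> {phi, e}).  So [bbF n] contains the space of
   functions of total degree n.  The bracket is graded skew-symmetric of
   degree -2,
     {phi, chi} = - (-1)^(|phi| |chi|) {chi, phi},   {e, e'} = <e, e'>,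
   and is computed on the above representation by the Jacobi identity
     {{phi, chi}, c} = {phi, {chi, c}} + (-1)^(|chi| |c|) {{phi, c}, chi}. *)
Section BigBracket.
Variables (C E : zmodType) (pairing : E -> E -> C).

Fixpoint bbF2 (n : nat) : zmodType * zmodType :=
  match n with
  | 0 => (C, E)
  | n'.+1 => ((bbF2 n').2, ((C -> (bbF2 n').1) * (E -> (bbF2 n').2))%type : zmodType)
  end.

Definition bbF (n : nat) : zmodType := (bbF2 n).1.

Definition bb_at (k : nat) := forall m n, bbF m -> bbF n -> bbF k.

(* {phi, chi} for m + n = 2 *)
Definition bb0 : bb_at 0 := fun m n =>
  match m, n return bbF m -> bbF n -> C with
  | 1, 1 => fun e e' => pairing e e'
  | 2, 0 => fun phi f => phi.1 f
  | 0, 2 => fun f chi => - chi.1 f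
  | _, _ => fun _ _ => 0
  end.

(* {phi, chi} for m + n = 3 *)
Definition bb1 : bb_at 1 := fun m n =>
  match m, n return bbF m -> bbF n -> E with
  | 2, 1 => fun phi e => phi.2 e
  | 1, 2 => fun e chi => - chi.2 e
  | 3, 0 => fun phi f => phi.1 f
  | 0, 3 => fun f chi => - chi.1 f
  | _, _ => fun _ _ => 0
  end.

(* {{phi, chi}, f} = {phi, {chi, f}} + {{phi, f}, chi} *)
Definition bb_fun (k : nat) (br : bb_at k) (m n : nat)
    (phi : bbF m) (chi : bbF n) (f : C) : bbF k :=
  match n return bbF n -> bbF k with
  | n'.+2 => fun chi => br m n' phi (chi.1 f)
  | _ => fun=> 0
  end chi
  + match m return bbF m -> bbF k with
    | m'.+2 => fun phi => br m' n (phi.1 f) chi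
    | _ => fun=> 0
    end phi.

(* {{phi, chi}, e} = {phi, {chi, e}} + (-1)^n {{phi, e}, chi} *)
Definition bb_sec (k : nat) (br : bb_at k) (m n : nat)
    (phi : bbF m) (chi : bbF n) (e : E) : bbF k :=
  match n return bbF n -> bbF k with
  | n'.+2 => fun chi => br m n'.+1 phi (chi.2 e)
  | 1 => fun chi => br m 0 phi (pairing chi e)
  | 0 => fun=> 0
  end chi
  + match m return bbF m -> bbF k with
    | m'.+2 => fun phi => br m'.+1 n (phi.2 e) chi
    | 1 => fun phi => br 0 n (pairing phi e) chi
    | 0 => fun=> 0
    end phi *~ (-1) ^+ n.

Fixpoint bb2 (k : nat) : bb_at k * bb_at k.+1 :=
  match k with
  | 0 => (bb0, bb1)
  | k'.+1 =>
    ((bb2 k').2,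
     fun m n phi chi => (bb_fun (bb2 k').1 phi chi, bb_sec (bb2 k').2 phi chi))
  end.

(* [bb k m n phi chi] is {phi, chi} provided that m + n = k + 2. *)
Definition bb (k : nat) : bb_at k := (bb2 k).1.

End BigBracket.

Section LieAlgebroid.
Variables (R : realType) (n : nat) (M : manifold R n) (r : nat).
Variable A : vbundle M r.

Local Notation C := (smooth_fun M).
Local Notation G := (gsection A).

(* Tensor fields are given by their action on sections: a vector bundle morphism is
   a C^\infty(M)-linear map between the modules of sections, a section of A^*
   is a C^\infty(M)-linear form on the sections of A, a section of TM is a
   derivation of C^\infty(M). *)
Local Notation G' := (dual G).

Record lie_algebroid := LieAlgebroid {
  la_anchor : G -> C -> C;
  la_bracket : G -> G -> G;
  la_anchor_linear : forall f X Y g,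
    la_anchor (f *: X + Y) g = f * la_anchor X g + la_anchor Y g;
  la_anchor_cst : forall X (a : R), la_anchor X (scst M a) = 0;
  la_anchorD : forall X f g,
    la_anchor X (f + g) = la_anchor X f + la_anchor X g;
  la_anchorM : forall X f g,
    la_anchor X (f * g) = la_anchor X f * g + f * la_anchor X g;
  la_bracket_linear : forall (a : R) X Y Z,
    la_bracket (scst M a *: X + Y) Z
      = scst M a *: la_bracket X Z + la_bracket Y Z;
  la_bracketC : forall X Y, la_bracket X Y = - la_bracket Y X;
  la_jacobi : forall X Y Z,
    la_bracket X (la_bracket Y Z)
      = la_bracket (la_bracket X Y) Z + la_bracket Y (la_bracket X Z);
  la_leibniz : forall X f Y,
    la_bracket X (f *: Y) = f *: la_bracket X Y + la_anchor X f *: Y;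
  la_anchor_bracket : forall X Y f,
    la_anchor (la_bracket X Y) f
      = la_anchor X (la_anchor Y f) - la_anchor Y (la_anchor X f)
}.

Record form2 := Form2 {
  form2_fun :> G -> G -> C;
  form2_linearl : forall Z f X Y,
    form2_fun (f *: X + Y) Z = f * form2_fun X Z + form2_fun Y Z;
  form2_linearr : forall X f Y Z,
    form2_fun X (f *: Y + Z) = f * form2_fun X Y + form2_fun X Z;
  form2_alt : forall X, form2_fun X X = 0
}.

Definition flat (w : form2) (X : G) : G' := Dual (form2_linearr w X).

Definition nondegenerate (w : form2) := bijective (flat w).

(* A bivector pi is given by pi^# : A^* -> A, with pi(a, b) = <b, pi^# a>. *)
Record bivector := Bivector {
  sharp : G' -> G;
  sharp_linear : forall f a b, sharp (f *: a + b) = f *: sharp a + sharp b;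
  sharp_alt : forall a : G', a (sharp a) = 0
}.

Definition inverse_of (w : form2) (p : bivector) :=
  forall X, sharp p (flat w X) = X.

(* A trivector psi is given by trisharp psi a b = psi(a, b, -) in A^** = A. *)
Record trivector := Trivector {
  trisharp : G' -> G' -> G;
  trisharp_linearl : forall c f a b,
    trisharp (f *: a + b) c = f *: trisharp a c + trisharp b c;
  trisharp_linearr : forall a f b c,
    trisharp a (f *: b + c) = f *: trisharp a b + trisharp a c;
  trisharp_altl : forall a, trisharp a a = 0;
  trisharp_altr : forall a b : G', b (trisharp a b) = 0
}.

Section Cartan.
Variable mu : lie_algebroid.
Local Notation rho := (la_anchor mu).
Local Notation "[< X , Y >]" := (la_bracket mu X Y).

Fact la_bracket_addr X Y Z : [< X, Y + Z >] = [< X, Y >] + [< X, Z >].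
Proof.
rewrite la_bracketC -[Y]scale1r (la_bracket_linear mu (1 : R)) scale1r opprD.
by rewrite scale1r -!(la_bracketC mu X).
Qed.

Fact dfunP g f X Y : rho (f *: X + Y) g = f * rho X g + rho Y g.
Proof. exact: la_anchor_linear. Qed.

Fact lieP X (b : G') f Y Z :
  rho X (b (f *: Y + Z)) - b [< X, f *: Y + Z >]
    = f * (rho X (b Y) - b [< X, Y >]) + (rho X (b Z) - b [< X, Z >]).
Proof.
have bD (U V : G) : b (U + V) = b U + b V.
  by have := dual_linear b 1 U V; rewrite scale1r mul1r.
have bZ g (U : G) : b (g *: U) = g * b U.
  have b0 : b 0 = 0 by apply: (addrI (b 0)); rewrite -bD !addr0.
  by have := dual_linear b g U 0; rewrite b0 !addr0.
rewrite dual_linear la_anchorD la_anchorM la_bracket_addr la_leibniz !bD !bZ.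
by ring.
Qed.

Definition dfun (f : C) : G' := Dual (dfunP f).

Definition lie (X : G) (b : G') : G' := Dual (lieP X b).

(* i_Y d a = L_Y a - d (a(Y)). *)
Definition int_d (Y : G) (a : G') : G' := lie Y a - dfun (a Y).

Definition dform2 (w : form2) (X Y Z : G) : C :=
  rho X (w Y Z) - rho Y (w X Z) + rho Z (w X Y)
  - w [< X, Y >] Z + w [< X, Z >] Y - w [< Y, Z >] X.

End Cartan.

(* Indices are in Z_3, so the index 3 of the triplets is 0 : 'Z_3. *)
Definition transition (omega : 'Z_3 -> form2) (p : 'Z_3 -> bivector)
    (i : 'Z_3) (X : G) : G :=
  sharp (p (i - 1)) (flat (omega (i + 1)) X).

Definition hypersymplectic_with_torsion (mu : lie_algebroid)
    (omega : 'Z_3 -> form2) (p : 'Z_3 -> bivector) :=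
  let N := transition omega p in
  [/\ forall i, nondegenerate (omega i),
      forall i, inverse_of (omega i) (p i),
      forall i X, N i (N i X) = - X &
      forall i j X Y Z,
        dform2 mu (omega i) (N i X) (N i Y) (N i Z)
          = dform2 mu (omega j) (N j X) (N j Y) (N j Z)].

Definition dblG : lmodType C := (G * G')%type.

Local Notation E := dblG.

Definition pairing (e e' : E) : C := e.2 e'.1 + e'.2 e.1.

Local Notation F := (bbF C E).
Local Notation "{[ x , y ]}_( k , m , n )" := (@bb C E pairing k m n x y).

(* {mu, f} = d f, {{mu, e}, f} = rho(e) f, {{mu, e}, e'} = [e, e'], since
   {mu, e} = {e, mu} *)
Definition bb_of_lie (mu : lie_algebroid) : F 3 :=
  (fun f => (0, dfun mu f),
   fun e =>
     (fun f => la_anchor mu e.1 f,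
      fun e' => (la_bracket mu e.1 e'.1,
                 lie mu e.1 e'.2 - int_d mu e'.1 e.2))).

(* {a, pi} = pi^# a, hence {pi, a} = - pi^# a *)
Definition bb_of_bivector (p : bivector) : F 2 :=
  (fun=> 0, fun e => (- sharp p e.2, 0)).

(* {{psi, a}, b} = - psi(a, b, -), with the same conventions *)
Definition bb_of_trivector (psi : trivector) : F 3 :=
  (fun=> 0, fun e => (fun=> 0, fun e' => (- trisharp psi e.2 e'.2, 0))).

Definition weak_poisson (mu : lie_algebroid) (p : bivector) :=
  let m := bb_of_lie mu in
  let q := bb_of_bivector p in
  {[ m, {[ {[ q, m ]}_(3, 2, 3), q ]}_(3, 3, 2) ]}_(4, 3, 3) = 0.

Record bracket_anchor := BracketAnchor {
  ca_anchor : E -> C -> C;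
  ca_bracket : E -> E -> E
}.

(* rho(e) f = {{e, Theta}, f} and [e, e'] = {{e, Theta}, e'} *)
Definition derived (Theta : F 3) : bracket_anchor := BracketAnchor
  (fun e f => {[ {[ e, Theta ]}_(2, 1, 3), f ]}_(0, 2, 0))
  (fun e e' => {[ {[ e, Theta ]}_(2, 1, 3), e' ]}_(1, 2, 1)).

Definition pre_courant (T : bracket_anchor) :=
  let rho := ca_anchor T in
  let br := ca_bracket T in
  [/\ forall f e e' g, rho (f *: e + e') g = f * rho e g + rho e' g,
      forall e, [/\ forall a : R, rho e (scst M a) = 0,
                    forall f g, rho e (f + g) = rho e f + rho e g &
                    forall f g, rho e (f * g) = rho e f * g + f * rho e g],
      forall (a : R) e e' e'',
        br (scst M a *: e + e') e'' = scst M a *: br e e'' + br e' e'' /\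
        br e'' (scst M a *: e + e') = scst M a *: br e'' e + br e'' e',
      forall e e' e'',
        rho e (pairing e' e'') = pairing (br e e') e'' + pairing e' (br e e'') &
      forall e e' e'',
        rho e (pairing e' e'') = pairing e (br e' e'' + br e'' e')].

Definition courant (T : bracket_anchor) :=
  pre_courant T /\
  forall e e' e'',
    ca_bracket T e (ca_bracket T e' e'')
      = ca_bracket T (ca_bracket T e e') e''
        + ca_bracket T e' (ca_bracket T e e'').

Definition deform (T : bracket_anchor) (I : E -> E) : bracket_anchor :=
  BracketAnchor
    (fun e => ca_anchor T (I e))
    (fun e e' => ca_bracket T (I e) e' + ca_bracket T e (I e')
                 - I (ca_bracket T e e')).

Definition opp_bracket_anchor (T : bracket_anchor) : bracket_anchor :=
  BracketAnchor (fun e f => - ca_anchor T e f) (fun e e' => - ca_bracket T e e').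

Definition hypersymplectic (T : bracket_anchor) (S : 'Z_3 -> E -> E) :=
  [/\ forall i f e e', S i (f *: e + e') = f *: S i e + S i e',
      forall i e e', pairing (S i e) e' = - pairing e (S i e'),
      forall i e, S i (S i e) = - e,
      forall i j e, i != j -> S i (S j e) = - S j (S i e) &
      forall i, deform (deform T (S i)) (S i) = opp_bracket_anchor T].

Definition Smx (w : form2) (p : bivector) (e : E) : E :=
  (- sharp p e.2, flat w e.1).

End LieAlgebroid.

(* Main.v *)
Require Import Defs.
From HB Require Import structures.
From mathcomp Require Import all_boot all_algebra.
From mathcomp Require Import ring.
From mathcomp Require Import all_classical all_reals all_analysis.
Set Implicit Arguments.
Unset Strict Implicit.
Unset Printing Implicit Defensive.
Import GRing.Theory.
Local Open Scope ring_scope.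

(* Write [psi] for a trivector and [g] for [omega_i N_i].  For a skew [S] with
   [S^2 = -1], [Theta_{S,S} = -Theta] says that the Nijenhuis torsion [T] of [S]
   vanishes, and [T(S e, e') = T(e, S e') = - S T(e, e')].  Since [S_i] maps A
   onto A^*, it is enough to look at [T] on A, where it vanishes iff
     [d omega_i (X, Y, Z) = - psi (omega_i X, omega_i Y, omega_i Z)].   (1)
   The algebraic relations among the [S_i] amount to [N_i^2 = -1], and they make
   [g] independent of i.  Evaluated on the image of [N_i], (1) reads
   [N_i d omega_i = - psi (g, g, g)], so that (1) holds for some [psi] and all i
   iff the [N_i d omega_i] coincide.  Finally (1) gives
   [{{pi_i, mu}, pi_i} = -2 psi], so weak-Poisson means [{mu, psi} = 0], which is
   the Courant condition for [mu + psi]. *)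

(** * Components of the big bracket *)

Section BigBracketComponents.
Variables (C E : zmodType) (pr : E -> E -> C).
Local Notation F := (bbF C E).
Local Notation "{[ x , y ]}_( k , m , n )" := (@bb C E pr k m n x y).

(* An element of [F k] is the pair of its brackets with functions ([bfun]) and
   with sections ([bsec]). *)
Definition bfun2 (x : F 2) : C -> C := x.1.
Definition bsec2 (x : F 2) : E -> E := x.2.
Definition bfun3 (x : F 3) : C -> E := x.1.
Definition bsec3 (x : F 3) : E -> F 2 := x.2.
Definition bfun4 (x : F 4) : C -> F 2 := x.1.
Definition bsec4 (x : F 4) : E -> F 3 := x.2.


Lemma bb_anchorE (x : F 3) (e : E) (f : C) :
 {[ {[ e, x ]}_(2, 1, 3), f ]}_(0, 2, 0) = pr e (bfun3 x f).
Proof. exact: addr0. Qed.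

(** Jacobi identity. The term $\{\{e,e'\},x\}$ carries the sign $(-1)^3$, and $\{f,x\}=-\{x,f\}$ for
    a function f, whence the plus sign before [bfun3]. *)
Lemma bb_dorfmanE (x : F 3) (e e' : E) :
 {[ {[ e, x ]}_(2, 1, 3), e' ]}_(1, 2, 1)
 = bfun3 x (pr e e') - bsec2 (bsec3 x e') e.
Proof. by rewrite addrC -[bfun3 x _]opprK. Qed.

Lemma bfun3D (x y : F 3) f : bfun3 (x + y) f = bfun3 x f + bfun3 y f.
Proof. by []. Qed.
Lemma bsec3D (x y : F 3) e : bsec3 (x + y) e = bsec3 x e + bsec3 y e.
Proof. by []. Qed.
Lemma bsec2D (x y : F 2) e : bsec2 (x + y) e = bsec2 x e + bsec2 y e.
Proof. by []. Qed.

Section B33.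
Variables x y : F 3.

(* In the names of the component lemmas, [f] and [s] record the type of each
   argument: function or section. *)
Lemma bb33_ff f g : bfun2 (bfun4 {[ x, y ]}_(4, 3, 3) f) g
   = pr (bfun3 x g) (bfun3 y f) + pr (bfun3 x f) (bfun3 y g).
Proof. by rewrite -[LHS]/((0 + _) + (_ + 0)) add0r addr0. Qed.

Lemma bb33_fs f e : bsec2 (bfun4 {[ x, y ]}_(4, 3, 3) f) e
   = bfun3 x (pr (bfun3 y f) e) - bsec2 (bsec3 x e) (bfun3 y f)
   + (bfun3 y (pr (bfun3 x f) e) - bsec2 (bsec3 y e) (bfun3 x f)).
Proof. by rewrite [X in _ + X]addrC -[bfun3 y (pr _ _)]opprK. Qed.

Lemma bb33_sf f e : bfun3 (bsec4 {[ x, y ]}_(4, 3, 3) e) f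
   = bfun3 x (bfun2 (bsec3 y e) f) - bsec2 (bsec3 y e) (bfun3 x f)
   - (bsec2 (bsec3 x e) (bfun3 y f) - bfun3 y (bfun2 (bsec3 x e) f)).
Proof. by []. Qed.

Lemma bb33_ssf e e' f : bfun2 (bsec3 (bsec4 {[ x, y ]}_(4, 3, 3) e) e') f
   = pr (bfun3 x f) (bsec2 (bsec3 y e) e')
   + (bfun2 (bsec3 x e') (bfun2 (bsec3 y e) f)
      - bfun2 (bsec3 y e) (bfun2 (bsec3 x e') f))
   - (bfun2 (bsec3 x e) (bfun2 (bsec3 y e') f)
      - bfun2 (bsec3 y e') (bfun2 (bsec3 x e) f)
      - pr (bsec2 (bsec3 x e) e') (bfun3 y f)).
Proof.
(* The zeros are brackets of a section with a function, which have degree -1. *)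
by rewrite -[LHS]/((0 + _) + (_ - _) - (_ - _ - (_ + 0))) add0r addr0.
Qed.

Lemma bb33_sss e e' e'' : bsec2 (bsec3 (bsec4 {[ x, y ]}_(4, 3, 3) e) e') e''
   = (bfun3 x (pr (bsec2 (bsec3 y e) e') e'')
      - bsec2 (bsec3 x e'') (bsec2 (bsec3 y e) e'))
   + (bsec2 (bsec3 x e') (bsec2 (bsec3 y e) e'')
      - bsec2 (bsec3 y e) (bsec2 (bsec3 x e') e''))
   - (bsec2 (bsec3 x e) (bsec2 (bsec3 y e') e'')
      - bsec2 (bsec3 y e') (bsec2 (bsec3 x e) e'')
      - (bfun3 y (pr (bsec2 (bsec3 x e) e') e'')
         - bsec2 (bsec3 y e'') (bsec2 (bsec3 x e) e'))).
Proof.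
by rewrite [X in _ - (_ - X)]addrC -[bfun3 y (pr _ _)]opprK.
Qed.
End B33.

Section B23.
Variables (q : F 2) (y : F 3).

Lemma bb23_f f :
  bfun3 {[ q, y ]}_(3, 2, 3) f = bsec2 q (bfun3 y f) - bfun3 y (bfun2 q f).
Proof. by []. Qed.

Lemma bb23_sf e f : bfun2 (bsec3 {[ q, y ]}_(3, 2, 3) e) f
  = bfun2 q (bfun2 (bsec3 y e) f) - bfun2 (bsec3 y e) (bfun2 q f)
   - pr (bsec2 q e) (bfun3 y f).
Proof. by rewrite -[LHS]/((_ - _) - (_ + 0)) addr0. Qed.

Lemma bb23_ss e e' : bsec2 (bsec3 {[ q, y ]}_(3, 2, 3) e) e'
  = bsec2 q (bsec2 (bsec3 y e) e') - bsec2 (bsec3 y e) (bsec2 q e')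
   - (bfun3 y (pr (bsec2 q e) e') - bsec2 (bsec3 y e') (bsec2 q e)).
Proof. by rewrite [X in _ - X]addrC -[bfun3 y (pr _ _)]opprK. Qed.

Lemma bb32_f f :
  bfun3 {[ y, q ]}_(3, 3, 2) f = bfun3 y (bfun2 q f) - bsec2 q (bfun3 y f).
Proof. by []. Qed.

Lemma bb32_sf e f : bfun2 (bsec3 {[ y, q ]}_(3, 3, 2) e) f
  = pr (bfun3 y f) (bsec2 q e)
   + (bfun2 (bsec3 y e) (bfun2 q f) - bfun2 q (bfun2 (bsec3 y e) f)).
Proof. by rewrite -[LHS]/((0 + _) + (_ - _)) add0r. Qed.

Lemma bb32_ss e e' : bsec2 (bsec3 {[ y, q ]}_(3, 3, 2) e) e'
  = bfun3 y (pr (bsec2 q e) e') - bsec2 (bsec3 y e') (bsec2 q e)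
   + (bsec2 (bsec3 y e) (bsec2 q e') - bsec2 q (bsec2 (bsec3 y e) e')).
Proof. by []. Qed.
End B23.

Lemma bbF2_ext (x y : F 2) : bfun2 x =1 bfun2 y -> bsec2 x =1 bsec2 y -> x = y.
Proof.
case: x y => x1 x2 [y1 y2] /boolp.funext h1 /boolp.funext h2.
exact: (f_equal2 pair h1 h2).
Qed.
Lemma bbF3_ext (x y : F 3) : bfun3 x =1 bfun3 y -> bsec3 x =1 bsec3 y -> x = y.
Proof.
case: x y => x1 x2 [y1 y2] /boolp.funext h1 /boolp.funext h2.
exact: (f_equal2 pair h1 h2).
Qed.
Lemma bbF4_ext (x y : F 4) : bfun4 x =1 bfun4 y -> bsec4 x =1 bsec4 y -> x = y.
Proof.
case: x y => x1 x2 [y1 y2] /boolp.funext h1 /boolp.funext h2.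
exact: (f_equal2 pair h1 h2).
Qed.

End BigBracketComponents.

(** * Nijenhuis torsion *)

Section NijenhuisTorsion.
Variables (V : zmodType) (B : V -> V -> V) (S : V -> V).
Hypotheses (BDl : forall x y z, B (x + y) z = B x z + B y z).
Hypotheses (BDr : forall x y z, B x (y + z) = B x y + B x z).
Hypotheses (SD : {morph S : x y / x + y}) (SS : forall x, S (S x) = - x).

Let B0l z : B 0 z = 0.
Proof. by apply: (addrI (B 0 z)); rewrite -BDl !addr0. Qed.
Let BNl x z : B (- x) z = - B x z.
Proof. by apply/eqP; rewrite -addr_eq0 -BDl addNr B0l. Qed.
Let B0r z : B z 0 = 0.
Proof. by apply: (addrI (B z 0)); rewrite -BDr !addr0. Qed.
Let BNr x z : B z (- x) = - B z x.
Proof. by apply/eqP; rewrite -addr_eq0 -BDr addNr B0r. Qed.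
Let S0 : S 0 = 0.
Proof. by apply: (addrI (S 0)); rewrite -SD !addr0. Qed.
Let SN x : S (- x) = - S x.
Proof. by apply/eqP; rewrite -addr_eq0 -SD addNr S0. Qed.

(** The Nijenhuis torsion, in which $S^2 B(x,y)$ has been replaced by $-B(x,y)$. *)
Definition torsion x y := B (S x) (S y) - S (B (S x) y + B x (S y)) - B x y.

Lemma torsionSl x y : torsion (S x) y = - S (torsion x y).
Proof.
rewrite /torsion !SS !SD !SN !SD !SS BNl BNl !SN !opprD !opprK.
by rewrite [LHS](AC (1*2*1) (3*(4*1)*2)).
Qed.

Lemma torsionSr x y : torsion x (S y) = - S (torsion x y).
Proof.
rewrite /torsion !SS !SD !SN !SD !SS !BNr !SN !opprD !opprK.
by rewrite [LHS](AC (1*2*1) (2*(1*4)*3)).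
Qed.

Lemma torsionDl x y z : torsion (x + y) z = torsion x z + torsion y z.
Proof.
rewrite /torsion !(SD, BDl) !opprD.
by rewrite [LHS](AC ((2*(2*2))*2) (((1*(3*5))*7)*((2*(4*6))*8))).
Qed.

Lemma torsionDr x y z : torsion x (y + z) = torsion x y + torsion x z.
Proof.
rewrite /torsion !(SD, BDr) !opprD.
by rewrite [LHS](AC ((2*(2*2))*2) (((1*(3*5))*7)*((2*(4*6))*8))).
Qed.

(** Twofold deformation: the mixed terms occur twice, and $S^2=-1$ turns the remaining ones into
    $-3B$, of which $-2B$ belongs to twice the torsion. *)
Lemma deform_bracket (B1 := fun x y => B (S x) y + B x (S y) - S (B x y)) x y :
  B1 (S x) y + B1 x (S y) - S (B1 x y) = - B x y + torsion x y *+ 2.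
Proof.
rewrite /B1 /torsion !SD !SN !SS BNl BNr !opprD !opprK mulr2n.
by rewrite [LHS](AC (3*3*3) (1*((2*(3*6)*5)*(4*(7*8)*9)))).
Qed.

End NijenhuisTorsion.

(** * The Dorfman bracket of a Lie algebroid *)

Section DualMorphism.
Variables (C : comPzRingType) (V : lmodType C).
HB.instance Definition _ (a : dual V) :=
  GRing.isLinear.Build C V C *%R a (dual_linear a).

Lemma dual0 (a : dual V) : a 0 = 0. Proof. exact: linear0. Qed.
Lemma dualN (a : dual V) X : a (- X) = - a X. Proof. exact: linearN. Qed.
Lemma dualD (a : dual V) X Y : a (X + Y) = a X + a Y.
Proof. exact: linearD. Qed.
Lemma dualB (a : dual V) X Y : a (X - Y) = a X - a Y.
Proof. exact: linearB. Qed.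
Lemma dualZ (a : dual V) f X : a (f *: X) = f * a X.
Proof. exact: linearZ. Qed.

Lemma dual_zeroE (X : V) : (0 : dual V) X = 0. Proof. by []. Qed.
Lemma dual_addE (a b : dual V) X : (a + b) X = a X + b X. Proof. by []. Qed.
Lemma dual_scaleE f (a : dual V) X : (f *: a) X = f * a X. Proof. by []. Qed.
Lemma dual_oppE (a : dual V) X : (- a) X = - a X.
Proof. exact: mulN1r. Qed.
Definition dualE := (dual_zeroE, dual_addE, dual_oppE, dual_scaleE).
End DualMorphism.

(** * Scalars: halving and absence of nilpotents *)

Section SmoothScalars.
Variables (R : realType) (n : nat) (M : manifold R n).
Local Notation C := (smooth_fun M).

(** The constant function 1/2 is a scalar, so 2 can be cancelled in every module over the smooth
    functions. *)
Lemma mulr2n_inj (V : lmodType C) : injective (fun x : V => x *+ 2).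
Proof.
have half2 : scst M 2^-1 + scst M 2^-1 = 1.
  by apply: smooth_fun_eq => x /=; rewrite [RHS](Num.Theory.splitr 1) !div1r.
have halfK (z : V) : scst M 2^-1 *: (z *+ 2) = z.
  by rewrite mulr2n scalerDr -scalerDl half2 scale1r.
by move=> x y /(congr1 ( *:%R (scst M 2^-1))); rewrite !halfK.
Qed.

Lemma smooth_sqr_eq0 (f : C) : f * f = 0 -> f = 0.
Proof.
move=> ff0; apply: smooth_fun_eq => x.
have /(congr1 (fun g : C => g x))/eqP := ff0.
by rewrite /= mulf_eq0 orbb => /eqP.
Qed.
End SmoothScalars.

(** * Linear algebra of 2-forms, bivectors and trivectors *)

Section Tensors.
Variables (R : realType) (n : nat) (M : manifold R n) (r : nat).
Variable A : vbundle M r.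
Local Notation C := (smooth_fun M).
Local Notation G := (gsection A).
Local Notation G' := (dual G).
Implicit Types (X Y Z : G) (a b c : G') (w : form2 A) (p : bivector A).
Implicit Types (psi : trivector A).

Fact flat_linear w f X Y : flat w (f *: X + Y) = f *: flat w X + flat w Y.
Proof. by apply: dual_eq => Z; exact: form2_linearl. Qed.
HB.instance Definition _ w :=
  GRing.isLinear.Build C G G' *:%R (flat w) (flat_linear w).
HB.instance Definition _ p :=
  GRing.isLinear.Build C G' G *:%R (sharp p) (sharp_linear p).
HB.instance Definition _ psi a :=
  GRing.isLinear.Build C G' G *:%R (trisharp psi a) (trisharp_linearr psi a).

Lemma flat0 w : flat w 0 = 0. Proof. exact: linear0. Qed.
Lemma flatN w X : flat w (- X) = - flat w X. Proof. exact: linearN. Qed.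
Lemma flatD w X Y : flat w (X + Y) = flat w X + flat w Y.
Proof. exact: linearD. Qed.
Lemma sharp0 p : sharp p 0 = 0. Proof. exact: linear0. Qed.
Lemma sharpN p a : sharp p (- a) = - sharp p a. Proof. exact: linearN. Qed.
Lemma sharpD p a b : sharp p (a + b) = sharp p a + sharp p b.
Proof. exact: linearD. Qed.
Lemma trisharp0 psi a : trisharp psi a 0 = 0. Proof. exact: linear0. Qed.
Lemma trisharpD psi a b c :
  trisharp psi a (b + c) = trisharp psi a b + trisharp psi a c.
Proof. exact: linearD. Qed.
Lemma trisharpZ psi a f b : trisharp psi a (f *: b) = f *: trisharp psi a b.
Proof. exact: linearZ. Qed.
Lemma trisharpDl psi a b c :
  trisharp psi (a + b) c = trisharp psi a c + trisharp psi b c.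
Proof. by have := trisharp_linearl psi c 1 a b; rewrite !scale1r. Qed.

Lemma flatE w X Y : flat w X Y = w X Y. Proof. by []. Qed.

(** Polarisation of the alternating condition, as in the three lemmas that follow. *)
Lemma flatC w X Y : flat w X Y = - flat w Y X.
Proof.
apply/eqP; rewrite -addr_eq0.
have := form2_alt w (X + Y); rewrite -flatE flatD !dualE !dualD.
by rewrite !flatE !form2_alt add0r addr0 => ->.
Qed.

Lemma sharpC p a b : a (sharp p b) = - b (sharp p a).
Proof.
apply/eqP; rewrite -addr_eq0.
have := sharp_alt p (a + b); rewrite sharpD dualD !dualE.
by rewrite !sharp_alt add0r addr0 addrC => ->.
Qed.

Lemma trisharpC psi a b : trisharp psi a b = - trisharp psi b a.
Proof.
apply/eqP; rewrite -addr_eq0.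
have := trisharp_altl psi (a + b).
by rewrite trisharpDl !trisharpD !trisharp_altl add0r addr0 => ->.
Qed.

Lemma trisharpCr psi a b c : b (trisharp psi a c) = - c (trisharp psi a b).
Proof.
apply/eqP; rewrite -addr_eq0.
have := trisharp_altr psi a (b + c); rewrite trisharpD dualD !dualE.
by rewrite !trisharp_altr add0r addr0 addrC => ->.
Qed.
End Tensors.

(** * Cartan calculus and the untwisted Dorfman bracket *)

Section LieAlgebroid.
Variables (R : realType) (n : nat) (M : manifold R n) (r : nat).
Variable A : vbundle M r.
Local Notation C := (smooth_fun M).
Local Notation G := (gsection A).
Local Notation G' := (dual G).
Local Notation E := (dblG A).
Implicit Types (X Y Z : G) (a b c : G') (f g : C) (e : E).
Variable mu : lie_algebroid A.
Local Notation rho := (la_anchor mu).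
Local Notation br := (la_bracket mu).

Fact rho_additive X : zmod_morphism (rho X).
Proof.
have rho0 : rho X 0 = 0 by apply: (addrI (rho X 0)); rewrite -la_anchorD !addr0.
move=> f g; rewrite la_anchorD; congr (_ + _).
by apply/eqP; rewrite -addr_eq0 -la_anchorD addNr rho0.
Qed.
HB.instance Definition _ X :=
  GRing.isZmodMorphism.Build C C (rho X) (rho_additive X).

Lemma rho0 X : rho X 0 = 0. Proof. exact: raddf0. Qed.
Lemma rhoN X f : rho X (- f) = - rho X f. Proof. exact: raddfN. Qed.
Lemma rhoD X f g : rho X (f + g) = rho X f + rho X g. Proof. exact: raddfD. Qed.
Lemma rhoB X f g : rho X (f - g) = rho X f - rho X g. Proof. exact: raddfB. Qed.

Fact br_additive X : zmod_morphism (br X).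
Proof.
have br0 : br X 0 = 0 by apply: (addrI (br X 0)); rewrite -la_bracket_addr !addr0.
move=> Y Z; rewrite la_bracket_addr; congr (_ + _).
by apply/eqP; rewrite -addr_eq0 -la_bracket_addr addNr br0.
Qed.
HB.instance Definition _ X :=
  GRing.isZmodMorphism.Build G G (br X) (br_additive X).

Lemma br0 X : br X 0 = 0. Proof. exact: raddf0. Qed.
Lemma brN X Y : br X (- Y) = - br X Y. Proof. exact: raddfN. Qed.
Lemma brD X Y Z : br X (Y + Z) = br X Y + br X Z. Proof. exact: raddfD. Qed.

Lemma rhoE X f : dfun mu f X = rho X f. Proof. by []. Qed.

Fact dfun_additive : zmod_morphism (dfun mu).
Proof. by move=> f g; apply: dual_eq => X; rewrite !dualE !rhoE rhoB. Qed.
HB.instance Definition _ :=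
  GRing.isZmodMorphism.Build C G' (dfun mu) dfun_additive.

Lemma dfun0 : dfun mu 0 = 0. Proof. exact: raddf0. Qed.
Lemma dfunM f g : dfun mu (f * g) = f *: dfun mu g + g *: dfun mu f.
Proof.
by apply: dual_eq => X; rewrite !dualE !rhoE la_anchorM; ring.
Qed.

Lemma rho0l f : rho 0 f = 0.
Proof. by rewrite -!rhoE dual0. Qed.
Lemma rhoNl X f : rho (- X) f = - rho X f.
Proof. by rewrite -!rhoE dualN. Qed.
Lemma rhoDl X Y f : rho (X + Y) f = rho X f + rho Y f.
Proof. by rewrite -!rhoE dualD. Qed.
Lemma rhoZl g X f : rho (g *: X) f = g * rho X f.
Proof. by rewrite -!rhoE dualZ. Qed.

Lemma br0l Z : br 0 Z = 0.
Proof. by rewrite la_bracketC br0 oppr0. Qed.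
Lemma brNl X Z : br (- X) Z = - br X Z.
Proof. by rewrite la_bracketC brN -!(la_bracketC mu _ Z). Qed.
Lemma brDl X Y Z : br (X + Y) Z = br X Z + br Y Z.
Proof. by rewrite la_bracketC brD opprD -!(la_bracketC mu _ Z). Qed.
Lemma brZl f X Z : br (f *: X) Z = f *: br X Z - rho Z f *: X.
Proof. by rewrite la_bracketC la_leibniz opprD -scalerN -(la_bracketC mu X). Qed.

Lemma lieE X b Y : lie mu X b Y = rho X (b Y) - b (br X Y).
Proof. by []. Qed.
Lemma int_dE X b Y :
  int_d mu X b Y = rho X (b Y) - b (br X Y) - rho Y (b X).
Proof. by rewrite /int_d !dualE lieE rhoE. Qed.

(* Locked: otherwise the unifier unfolds [(dorfman e e').2] to a sum of forms. *)
Definition dorfman (e e' : E) : E :=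
  locked (br e.1 e'.1, lie mu e.1 e'.2 - int_d mu e'.1 e.2).

(** The operator $f\mapsto\{\mu,f\}$ of the Courant algebroid. *)
Definition dgrad f : E := (0, dfun mu f).

Lemma dbl_eq (e e' : E) : e.1 = e'.1 -> (forall Z, e.2 Z = e'.2 Z) -> e = e'.
Proof. by case: e e' => [X a] [Y b] /= -> /dual_eq ->. Qed.

Lemma dbl_add1 e e' : (e + e').1 = e.1 + e'.1. Proof. by []. Qed.
Lemma dbl_add2 e e' : (e + e').2 = e.2 + e'.2. Proof. by []. Qed.
Lemma dbl_opp1 e : (- e).1 = - e.1. Proof. by []. Qed.
Lemma dbl_opp2 e : (- e).2 = - e.2. Proof. by []. Qed.
Lemma dbl_scale1 f e : (f *: e).1 = f *: e.1. Proof. by []. Qed.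
Lemma dbl_scale2 f e : (f *: e).2 = f *: e.2. Proof. by []. Qed.
Definition dblE :=
  (dbl_add1, dbl_add2, dbl_opp1, dbl_opp2, dbl_scale1, dbl_scale2).

Lemma dorfman1E e e' : (dorfman e e').1 = br e.1 e'.1.
Proof. by rewrite /dorfman -lock. Qed.

Lemma dorfman2E e e' Z :
  (dorfman e e').2 Z = rho e.1 (e'.2 Z) - e'.2 (br e.1 Z)
    - (rho e'.1 (e.2 Z) - e.2 (br e'.1 Z) - rho Z (e.2 e'.1)).
Proof.
rewrite /dorfman -lock -[LHS]/((lie mu e.1 e'.2 - int_d mu e'.1 e.2) Z).
by rewrite dual_addE dual_oppE lieE int_dE.
Qed.

(** The A-component is the Jacobi identity of A. The A^*-component, tested on W, needs that the
    anchor preserves brackets and three Jacobi identities with W in the last slot. *)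
Lemma dorfman_jacobi e e' e'' :
  dorfman e (dorfman e' e'')
    = dorfman (dorfman e e') e'' + dorfman e' (dorfman e e'').
Proof.
apply: dbl_eq => [|W]; first by rewrite dbl_add1 !dorfman1E; exact: la_jacobi.
rewrite dbl_add2 dual_addE !(dorfman2E, dorfman1E).
rewrite !(rhoB, rhoD, rhoN) !la_anchor_bracket.
rewrite (la_jacobi mu e.1 e'.1 W) (la_jacobi mu e.1 e''.1 W).
rewrite (la_jacobi mu e'.1 e''.1 W) !dualD.
by ring.
Qed.

Lemma dorfmanDl e1 e2 e : dorfman (e1 + e2) e = dorfman e1 e + dorfman e2 e.
Proof.
apply: dbl_eq => [|W]; rewrite !dblE ?dualE !(dorfman1E, dorfman2E) !dblE ?brDl //.
by rewrite !dualE !(brDl, rhoDl, rhoD, dualD); ring.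
Qed.

Lemma dorfmanDr e e1 e2 : dorfman e (e1 + e2) = dorfman e e1 + dorfman e e2.
Proof.
apply: dbl_eq => [|W]; rewrite !dblE ?dualE !(dorfman1E, dorfman2E) !dblE ?brD //.
by rewrite !dualE !(brDl, rhoDl, rhoD, dualD); ring.
Qed.

Lemma dorfmanZl (t : R) e1 e :
  dorfman (scst M t *: e1) e = scst M t *: dorfman e1 e.
Proof.
apply: dbl_eq => [|W]; rewrite !dblE ?dualE !(dorfman1E, dorfman2E) !dblE.
  by rewrite brZl la_anchor_cst scale0r subr0.
rewrite !dualE !(brZl, rhoZl, la_anchorM, la_anchor_cst, dualB, dualZ).
by ring.
Qed.

Lemma dorfmanZr (t : R) e e1 :
  dorfman e (scst M t *: e1) = scst M t *: dorfman e e1.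
Proof.
apply: dbl_eq => [|W]; rewrite !dblE ?dualE !(dorfman1E, dorfman2E) !dblE.
  by rewrite la_leibniz la_anchor_cst scale0r addr0.
rewrite !dualE !(brZl, rhoZl, la_anchorM, la_anchor_cst, dualB, dualZ).
by ring.
Qed.

Lemma pairingC e e' : pairing e e' = pairing e' e.
Proof. by rewrite /pairing addrC. Qed.

Lemma dorfmanC e e' : dorfman e e' + dorfman e' e = dgrad (pairing e e').
Proof.
apply: dbl_eq => [|W]; rewrite !dblE ?dualE !(dorfman1E, dorfman2E).
  by rewrite la_bracketC addNr.
by rewrite rhoE /pairing rhoD; ring.
Qed.

(** This is $d^2f=0$, that is, compatibility of the anchor with brackets. *)
Lemma dorfman_dgradl f e : dorfman (dgrad f) e = 0.
Proof.
apply: dbl_eq => [|W]; rewrite !(dorfman1E, dorfman2E).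
  by rewrite br0l.
rewrite br0l rho0l dual0 !rhoE la_anchor_bracket dual_zeroE.
by ring.
Qed.

Lemma pairing_dgradr e f : pairing e (dgrad f) = rho e.1 f.
Proof. by rewrite /pairing dual0 add0r rhoE. Qed.

Lemma dorfman_invariant e e' e'' :
  rho e.1 (pairing e' e'')
    = pairing (dorfman e e') e'' + pairing e' (dorfman e e'').
Proof.
rewrite /pairing rhoD !(dorfman1E, dorfman2E).
rewrite (la_bracketC mu e''.1 e'.1) dualN; ring.
Qed.

(** * Twisting by a trivector *)

Section Trivector.
Variable psi : trivector A.

(* The contribution of [psi] to the derived bracket of [mu + psi]. *)
Definition tri_op e e' : E := locked (- trisharp psi e.2 e'.2, 0).

Lemma tri_op1E e e' : (tri_op e e').1 = - trisharp psi e.2 e'.2.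
Proof. by rewrite /tri_op -lock. Qed.
Lemma tri_op2E e e' : (tri_op e e').2 = 0.
Proof. by rewrite /tri_op -lock. Qed.

Lemma tri_op_eq e e' e'' : tri_op e e' = e'' <->
  - trisharp psi e.2 e'.2 = e''.1 /\ 0 = e''.2.
Proof.
rewrite /tri_op -lock; split=> [<- //|]; case: e'' => X a /= [<- <-] //.
Qed.

Lemma tri_opDr e e1 e2 : tri_op e (e1 + e2) = tri_op e e1 + tri_op e e2.
Proof.
apply/tri_op_eq; rewrite !dblE !tri_op1E !tri_op2E addr0.
by rewrite trisharpD opprD.
Qed.

Lemma tri_opZr f e e1 : tri_op e (f *: e1) = f *: tri_op e e1.
Proof.
apply/tri_op_eq; rewrite !dblE tri_op1E tri_op2E scaler0.
by rewrite trisharpZ scalerN.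
Qed.

Lemma tri_opC e e' : tri_op e e' = - tri_op e' e.
Proof.
apply/tri_op_eq; rewrite !dblE tri_op1E tri_op2E oppr0.
by rewrite trisharpC.
Qed.

Lemma tri_opDl e1 e2 e : tri_op (e1 + e2) e = tri_op e1 e + tri_op e2 e.
Proof. by rewrite tri_opC tri_opDr opprD -!(tri_opC _ e). Qed.

Lemma tri_opZl f e1 e : tri_op (f *: e1) e = f *: tri_op e1 e.
Proof. by rewrite tri_opC tri_opZr -scalerN -tri_opC. Qed.

(** [tri_op] reads only A^*-components and takes its values in A; hence the Jacobi identity of
    $\mu+\psi$ has no term quadratic in [psi]. *)
Lemma tri_op_tri e e' e'' : tri_op e (tri_op e' e'') = 0.
Proof. by apply/tri_op_eq; rewrite tri_op2E trisharp0 oppr0. Qed.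

Lemma tri_op_invariant e e' e'' :
  pairing (tri_op e e') e'' + pairing e' (tri_op e e'') = 0.
Proof.
rewrite /pairing !tri_op1E !tri_op2E !dual_zeroE !dualN (trisharpCr psi _ e''.2).
by rewrite trisharpC dualN; ring.
Qed.

End Trivector.

Lemma dorfman0r e : dorfman e 0 = 0.
Proof. by apply: (addrI (dorfman e 0)); rewrite -dorfmanDr !addr0. Qed.
Lemma dgrad0 : dgrad 0 = 0.
Proof. by rewrite /dgrad dfun0. Qed.

Lemma pairing0l e : pairing 0 e = 0.
Proof. by rewrite /pairing dual0 addr0. Qed.
Lemma pairing0r e : pairing e 0 = 0.
Proof. by rewrite pairingC pairing0l. Qed.

(** * The derived bracket of $\mu+\psi$ and the components of $\{\mu,\psi\}$ *)

Section LieTrivectorBracket.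
Variable psi : trivector A.
Local Notation tri_op := (tri_op psi).

Let m := bb_of_lie mu.
Let t := bb_of_trivector psi.

Lemma bfun3_lie f : bfun3 m f = dgrad f. Proof. by []. Qed.
Lemma bfun2_lie e f : bfun2 (bsec3 m e) f = rho e.1 f. Proof. by []. Qed.
Lemma bsec2_lie e e' : bsec2 (bsec3 m e) e' = dorfman e e'.
Proof. by rewrite /dorfman -lock. Qed.
Lemma bfun3_tri f : bfun3 t f = 0. Proof. by []. Qed.
Lemma bfun2_tri e f : bfun2 (bsec3 t e) f = 0. Proof. by []. Qed.
Lemma bsec2_tri e e' : bsec2 (bsec3 t e) e' = tri_op e e'.
Proof. by rewrite /tri_op -lock. Qed.
Definition bb_lie_triE :=
  (bfun3_lie, bfun2_lie, bsec2_lie, bfun3_tri, bfun2_tri, bsec2_tri).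

Lemma derivedE :
  derived (m + t)
  = BracketAnchor (fun e f => rho e.1 f) (fun e e' => dorfman e e' + tri_op e e').
Proof.
congr BracketAnchor; apply/funext => e; apply/funext => f.
  by rewrite bb_anchorE bfun3D !bb_lie_triE addr0 pairing_dgradr.
(* The big bracket yields $D\langle e,e'\rangle-[e',e]$ for [mu], which [dorfmanC] identifies with
   $[e,e']$; the [psi] part is skew and has no such correction. *)
rewrite bb_dorfmanE bfun3D bsec3D bsec2D !bb_lie_triE addr0 -dorfmanC.
by rewrite opprD addrA addrK -tri_opC.
Qed.

(* The part of the Jacobi identity of [mu + psi] that is linear in [psi]. *)
Definition jacobi_defect e e' e'' : E :=
  dorfman e (tri_op e' e'') + tri_op e (dorfman e' e'')
  - ((dorfman (tri_op e e') e'' + tri_op (dorfman e e') e'')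
     + (dorfman e' (tri_op e e'') + tri_op e' (dorfman e e''))).

(** The part free of [psi] is [dorfman_jacobi] and the quadratic part vanishes by [tri_op_tri], so
    only the linear part remains. *)
Lemma jacobi_defectP e e' e'' (B := fun e e' => dorfman e e' + tri_op e e') :
  B e (B e' e'') = B (B e e') e'' + B e' (B e e'') <-> jacobi_defect e e' e'' = 0.
Proof.
have rearrange (V : zmodType) (x y a b c d a' b' : V) :
    x + y + a + b = x + c + d + (y + a' + b')
    <-> a + b - ((c + d) + (a' + b')) = 0.
  rewrite -(addrA _ a b) -(addrA x c) -(addrA y a') (addrACA x (c + d)).
  by split=> [/addrI ->|/subr0_eq -> //]; exact: subrr.
rewrite /B !dorfmanDr !dorfmanDl !tri_opDr !tri_opDl !tri_op_tri.
rewrite (tri_opC psi (tri_op e e')) tri_op_tri oppr0 !addr0 dorfman_jacobi.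
exact: rearrange.
Qed.

(** The component on three sections is minus the Jacobi defect. The other components involve [psi]
    only through $\psi(df,\cdot,\cdot)$, and one of them gives exactly this tensor. *)
Lemma bb_lie_triP :
  bb (pairing (A:=A)) 4 m t = 0 <->
  (forall a f, trisharp psi a (dfun mu f) = 0)
  /\ (forall e e' e'', jacobi_defect e e' e'' = 0).
Proof.
have sec e e' e'' : bsec2 (bsec3 (bsec4 (bb (pairing (A:=A)) 4 m t) e) e') e''
    = - jacobi_defect e e' e''.
  rewrite bb33_sss !bb_lie_triE -dorfmanC addrK sub0r -(tri_opC psi _ e'').
  rewrite /jacobi_defect !opprD !opprK.
  by rewrite [RHS](AC (2*(2*2)) ((3*(5*2))*((1*6)*4))).
split=> [H|[Hd HJ]].
  split=> [a f|e e' e''].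
    have := congr1 (fun x => bfun3 (bsec4 x (0, a)) f) H.
    rewrite bb33_sf !bb_lie_triE dgrad0 dorfman0r !subr0 sub0r.
    move=> /(congr1 (fun e => e.1)).
    by rewrite dbl_opp1 tri_op1E opprK.
  have := congr1 (fun x => bsec2 (bsec3 (bsec4 x e) e') e'') H.
  by rewrite sec => /eqP; rewrite oppr_eq0 => /eqP.
have Td e f : tri_op e (dgrad f) = 0.
  by apply/tri_op_eq; rewrite Hd oppr0.
apply: bbF4_ext => [f|e].
  apply: bbF2_ext => [g|e].
    by rewrite bb33_ff !bb_lie_triE !pairing0r addr0.
  rewrite bb33_fs !bb_lie_triE Td pairing0l dgrad0 dorfman0r.
  by rewrite !subr0 addr0.
apply: bbF3_ext => [f|e'].
  by rewrite bb33_sf !bb_lie_triE Td dgrad0 dorfman0r !subr0.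
apply: bbF2_ext => [g|e''].
  rewrite bb33_ssf !bb_lie_triE /pairing tri_op2E tri_op1E dual_zeroE addr0.
  by rewrite dualN trisharpCr Hd dual0 !oppr0 !rho0 dual0 !addr0 !subr0.
by rewrite sec HJ oppr0.
Qed.
End LieTrivectorBracket.

Local Notation "{[ x , y ]}_( k , m , n )" :=
  (@bb C E (@pairing _ _ _ _ A) k m n x y).

Lemma pairingZl f e e' : pairing (f *: e) e' = f * pairing e e'.
Proof. by rewrite /pairing !dblE dualZ dual_scaleE mulrDr. Qed.

(* The Jacobi identity gives [[D<e, e'>, -] = 0], hence [psi(df, c, -) = 0] for f
   in the ideal spanned by the pairings.  The general case follows without
   partitions of unity: with X = psi(df, c, -) and h = b(X) = <X, b>, both h and
   f h are pairings, so that h X = 0 and h^2 = b(h X) = 0. *)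
Lemma courant_derivedP (psi : trivector A) :
  (forall X, (forall a : G', a X = 0) -> X = 0) ->
  courant (derived (bb_of_lie mu + bb_of_trivector psi)) <->
  {[ bb_of_lie mu, bb_of_trivector psi ]}_(4, 3, 3) = 0.
Proof.
move=> sep; rewrite bb_lie_triP derivedE; split=> [[_ J]|[Hd K]].
  have {}K e e' e'' : jacobi_defect psi e e' e'' = 0 by apply/jacobi_defectP/J.
  split=> // c f; rewrite trisharpC -[RHS]oppr0; congr (- _).
  have dpair h e e' : h = pairing e e' -> trisharp psi (dfun mu h) c = 0.
    move=> ->; pose B e e' := dorfman e e' + tri_op psi e e'.
    have BDl e1 e2 e3 : B (e1 + e2) e3 = B e1 e3 + B e2 e3.
      by rewrite /B dorfmanDl tri_opDl addrACA.
    (* Add the Jacobi identities for (e, e') and (e', e); the inner sum is then $D\langle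
       e,e'\rangle$. *)
    have : B (B e e' + B e' e) (0, c) = 0.
      have cancel (V : zmodType) (u v x y : V) : u = x + v -> v = y + u -> x + y = 0.
        by move=> -> vE; apply: (addIr v); rewrite add0r [RHS]vE (addrC x) -addrA.
      by rewrite BDl; exact: cancel (J e e' (0, c)) (J e' e (0, c)).
    rewrite {2 3}/B (tri_opC psi e') addrACA subrr addr0 dorfmanC.
    rewrite /B dorfman_dgradl add0r => /tri_op_eq[/eqP].
    by rewrite oppr_eq0 => /eqP.
  set X := trisharp psi (dfun mu f) c.
  apply: sep => b; apply: smooth_sqr_eq0.
  have hE : b X = pairing (X, 0) (0, b) by rewrite /pairing dual_zeroE add0r.
  have fhE : f * b X = pairing (f *: (X, 0)) (0, b) by rewrite pairingZl hE.
  have := dpair _ _ _ fhE; rewrite dfunM trisharpDl !(trisharpC psi _ c) !trisharpZ.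
  rewrite -!scalerN -!trisharpC (dpair _ _ _ hE) scaler0 add0r.
  by move=> /(congr1 b); rewrite dualZ dual0.
(* The pre-Courant axioms below hold for every [psi]; the Jacobi identity is the vanishing of the
   defect. *)
split=> [|e e' e'']; last exact/jacobi_defectP.
split=> /=.
- by move=> f e e' g; rewrite la_anchor_linear.
- move=> e; split=> [a|f g|f g]; first exact: la_anchor_cst.
    exact: la_anchorD.
  exact: la_anchorM.
- move=> a e e' e''; split.
    by rewrite dorfmanDl dorfmanZl tri_opDl tri_opZl scalerDr addrACA.
  by rewrite dorfmanDr dorfmanZr tri_opDr tri_opZr scalerDr addrACA.
- move=> e e' e''; rewrite dorfman_invariant.
  have pDl (u v w : E) : pairing (u + v) w = pairing u w + pairing v w.
    by rewrite /pairing !dblE dualD dual_addE addrACA.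
  have pDr (u v w : E) : pairing u (v + w) = pairing u v + pairing u w.
    by rewrite pairingC pDl -!(pairingC u).
  by rewrite pDl pDr [RHS]addrACA tri_op_invariant addr0.
- move=> e e' e''.
  by rewrite (tri_opC psi e'') addrACA subrr addr0 dorfmanC pairing_dgradr.
Qed.

(** * Constant multiples of a trivector *)

Section Scale.
Variables (s : R) (psi : trivector A).

Fact triscale_linearl c f a b : scst M s *: trisharp psi (f *: a + b) c =
  f *: (scst M s *: trisharp psi a c) + scst M s *: trisharp psi b c.
Proof. by rewrite trisharp_linearl scalerDr !scalerA mulrC. Qed.
Fact triscale_linearr a f b c : scst M s *: trisharp psi a (f *: b + c) =
  f *: (scst M s *: trisharp psi a b) + scst M s *: trisharp psi a c.
Proof. by rewrite trisharp_linearr scalerDr !scalerA mulrC. Qed.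
Fact triscale_altl a : scst M s *: trisharp psi a a = 0.
Proof. by rewrite trisharp_altl scaler0. Qed.
Fact triscale_altr a b : b (scst M s *: trisharp psi a b) = 0.
Proof. by rewrite dualZ trisharp_altr mulr0. Qed.
Definition triscale : trivector A :=
  Trivector triscale_linearl triscale_linearr triscale_altl triscale_altr.

Lemma tri_op_scale e e' : tri_op triscale e e' = scst M s *: tri_op psi e e'.
Proof.
apply/tri_op_eq; rewrite !dblE tri_op1E tri_op2E scaler0.
by rewrite scalerN.
Qed.

Lemma jacobi_defect_scale e e' e'' :
  jacobi_defect triscale e e' e'' = scst M s *: jacobi_defect psi e e' e''.
Proof.
rewrite /jacobi_defect !tri_op_scale !(dorfmanZl, dorfmanZr).
by rewrite -!scalerDr -scalerBr.
Qed.

(** Both conditions of [bb_lie_triP] are homogeneous in [psi], as the anchor kills the constant s,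
    and s is invertible. It serves for s = -2. *)
Lemma bb_lie_tri_scaleP : s != 0 ->
  {[ bb_of_lie mu, bb_of_trivector triscale ]}_(4, 3, 3) = 0 <->
  {[ bb_of_lie mu, bb_of_trivector psi ]}_(4, 3, 3) = 0.
Proof.
move=> s0; have scale_eq0 (V : lmodType C) (x : V) : scst M s *: x = 0 <-> x = 0.
  split=> [sx0|->]; last exact: scaler0.
  have <- : scst M s^-1 *: (scst M s *: x) = x.
    rewrite scalerA (_ : _ * _ = 1) ?scale1r //.
    by apply: smooth_fun_eq => y /=; rewrite mulVf.
  by rewrite sx0 scaler0.
split=> /bb_lie_triP[Hd K]; apply/bb_lie_triP; split=> [a f|e e' e''].
- exact/scale_eq0/Hd.
- by apply/scale_eq0; rewrite -jacobi_defect_scale.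
- by rewrite -[LHS]/(scst M s *: trisharp psi a (dfun mu f)) Hd scaler0.
- by rewrite jacobi_defect_scale K scaler0.
Qed.
End Scale.

(** * Compatibility of 2-forms, bivectors and trivectors *)

Section FormTrivector.
Variables (w : form2 A) (p : bivector A).
Local Notation dw := (dform2 mu w).

Let wDl X Y Z : w (X + Y) Z = w X Z + w Y Z.
Proof. by rewrite -!flatE flatD. Qed.
Let wZl f X Z : w (f *: X) Z = f * w X Z.
Proof. by rewrite -!flatE linearZ. Qed.
Let wDr X Y Z : w Z (X + Y) = w Z X + w Z Y.
Proof. by rewrite -!flatE dualD. Qed.
Let wZr f X Z : w Z (f *: X) = f * w Z X.
Proof. by rewrite -!flatE dualZ. Qed.
Let wC X Y : w X Y = - w Y X. Proof. by rewrite -!flatE flatC. Qed.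

Lemma dform2_swap12 X Y Z : dw X Y Z = - dw Y X Z.
Proof.
rewrite /dform2 (wC X Y) (la_bracketC mu X Y).
rewrite -[w (- _) Z]flatE flatN dual_oppE flatE.
by rewrite rhoN; ring.
Qed.

Lemma dform2_swap23 X Y Z : dw X Y Z = - dw X Z Y.
Proof.
rewrite /dform2 (wC Y Z) (la_bracketC mu Y Z).
rewrite -[w (- _) X]flatE flatN dual_oppE flatE.
by rewrite rhoN; ring.
Qed.

Lemma dform2_alt12 X Z : dw X X Z = 0.
Proof.
(* Skew-symmetry only gives $2[X,X]=0$. *)
have br_alt : br X X = 0.
  apply: (@mulr2n_inj _ _ M); rewrite mul0rn mulr2n {2}la_bracketC.
  exact: subrr.
rewrite /dform2 form2_alt br_alt -[w 0 Z]flatE rho0 flat0 dual_zeroE.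
by ring.
Qed.

(** Tensoriality: the derivatives of f produced by the anchor terms cancel those coming from the
    Leibniz rule in the brackets. *)
Fact dform2_linearr X Y f Z W : dw X Y (f *: Z + W) = f * dw X Y Z + dw X Y W.
Proof.
rewrite /dform2 !(wDr, wZr) rhoDl rhoZl !rhoD !la_anchorM !brD !la_leibniz.
rewrite !(wDl, wZl) (wC Z X) (wC Z Y).
by ring.
Qed.

Lemma dform2_linearm X Z f Y W : dw X (f *: Y + W) Z = f * dw X Y Z + dw X W Z.
Proof. by rewrite dform2_swap23 dform2_linearr opprD -mulrN -!dform2_swap23. Qed.

Lemma dform2_linearl Y Z f X W : dw (f *: X + W) Y Z = f * dw X Y Z + dw W Y Z.
Proof. by rewrite dform2_swap12 dform2_linearm opprD -mulrN -!dform2_swap12. Qed.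

Definition int_dform2 X Y : G' := Dual (dform2_linearr X Y).

Fact form_tri_linearl c f a b :
  sharp p (int_dform2 (sharp p (f *: a + b)) (sharp p c))
    = f *: sharp p (int_dform2 (sharp p a) (sharp p c))
      + sharp p (int_dform2 (sharp p b) (sharp p c)).
Proof.
rewrite -sharp_linear; congr sharp; apply: dual_eq => Z.
by rewrite dual_addE dual_scaleE /= sharp_linear dform2_linearl.
Qed.
Fact form_tri_linearr a f b c :
  sharp p (int_dform2 (sharp p a) (sharp p (f *: b + c)))
    = f *: sharp p (int_dform2 (sharp p a) (sharp p b))
      + sharp p (int_dform2 (sharp p a) (sharp p c)).
Proof.
rewrite -sharp_linear; congr sharp; apply: dual_eq => Z.
by rewrite dual_addE dual_scaleE /= sharp_linear dform2_linearm.
Qed.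
Fact form_tri_altl a : sharp p (int_dform2 (sharp p a) (sharp p a)) = 0.
Proof.
by rewrite -[RHS](sharp0 p); congr sharp; apply: dual_eq => Z; exact: dform2_alt12.
Qed.
Fact form_tri_altr a b : b (sharp p (int_dform2 (sharp p a) (sharp p b))) = 0.
Proof.
rewrite sharpC -[RHS]oppr0; congr (- _).
by rewrite /= dform2_swap12 dform2_swap23 dform2_alt12 !oppr0.
Qed.

(** $\psi(a,b,c)=-d\omega(\pi^\sharp a,\pi^\sharp b,\pi^\sharp c)$, which solves equation (1) for
    [psi] when [p] is the inverse of [w]. *)
Definition form_tri : trivector A :=
  Trivector form_tri_linearl form_tri_linearr form_tri_altl form_tri_altr.
End FormTrivector.

Definition integrability w psi := forall X Y Z,
  dform2 mu w X Y Z = - flat w Z (trisharp psi (flat w X) (flat w Y)).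

Section Inverse.
Variables (w : form2 A) (p : bivector A).
Hypotheses (pK : cancel (flat w) (sharp p)) (wK : cancel (sharp p) (flat w)).

Lemma integrability_form_tri : integrability w (form_tri w p).
Proof.
by move=> X Y Z; rewrite [trisharp _ _ _]/= flatC opprK wK !pK.
Qed.

Section Torsion.
Variable psi : trivector A.
Local Notation q := (bb_of_bivector p).

Let Q e : E := locked (- sharp p e.2, 0).
Let Q1 e : (Q e).1 = - sharp p e.2. Proof. by rewrite /Q -lock. Qed.
Let Q2 e : (Q e).2 = 0. Proof. by rewrite /Q -lock. Qed.
Let Q_eq e e' : - sharp p e.2 = e'.1 -> 0 = e'.2 -> Q e = e'.
Proof. by rewrite /Q -lock; case: e' => ? ? /= <- <-. Qed.
Let QD e e' : Q (e + e') = Q e + Q e'.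
Proof. by apply: Q_eq; rewrite !dblE ?(Q2, Q1) ?addr0 // sharpD opprD. Qed.
Let Q0 : Q 0 = 0. Proof. by apply: Q_eq; rewrite // sharp0 oppr0. Qed.
Let QN e : Q (- e) = - Q e.
Proof. by apply/eqP; rewrite -addr_eq0 -QD addNr Q0. Qed.
Let QQ e : Q (Q e) = 0. Proof. by apply: Q_eq; rewrite // Q2 sharp0 oppr0. Qed.
Let bfun2_q f : bfun2 q f = 0. Proof. by []. Qed.
Let bsec2_q e : bsec2 q e = Q e. Proof. by rewrite /Q -lock. Qed.
Let pQQ e e' : pairing (Q e) (Q e') = 0.
Proof. by rewrite /pairing !Q2 !dual_zeroE addr0. Qed.

(* Up to a factor, the left-hand side is [{{q, mu}, q}] evaluated at e and e'. *)
Lemma schouten_tri : integrability w psi -> forall e e',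
  Q (dorfman (Q e) e') + Q (dorfman e (Q e')) - dorfman (Q e) (Q e')
  = - tri_op psi e e'.
Proof.
move=> dwE e e'; apply: dbl_eq => [|Z]; rewrite !dblE !(Q1, Q2, tri_op1E, tri_op2E).
  (* A-components are compared after applying [flat w]. With e and e' written through X and Y, the
     claim becomes the Cartan formula for $d\omega(X,Y,Z)$. *)
  apply: (can_inj pK); apply: dual_eq => Z.
  rewrite opprK dorfman1E !Q1 brNl brN opprK !flatD !flatN !wK !dualE.
  rewrite !dorfman2E !Q1 !Q2.
  set X := sharp p e.2; set Y := sharp p e'.2.
  have [eX e'Y] : e.2 = flat w X /\ e'.2 = flat w Y by rewrite !wK.
  rewrite eX e'Y; have := dwE X Y Z; rewrite (flatC w Z) opprK => <-.
  rewrite /dform2 -!flatE (flatC w (br X Z) Y) (flatC w (br Y Z) X).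
  by rewrite !(rhoNl, brNl, dualN, dual_zeroE, rho0, rhoN); ring.
by rewrite !dualE dorfman2E !Q2 !dual_zeroE !rho0; ring.
Qed.

(** Here [Q] is $\{\pi,-\}$. It squares to zero and has isotropic image, so on sections the double
    bracket is twice the expression in [schouten_tri], and its components on functions vanish. *)
Lemma bb_bivector_tri : integrability w psi ->
  {[ {[ q, bb_of_lie mu ]}_(3, 2, 3), q ]}_(3, 3, 2)
  = bb_of_trivector (triscale (- 2) psi).
Proof.
move=> /schouten_tri sch; set s := {[ q, _ ]}_(3, 2, 3).
have sf f : bfun3 s f = Q (dgrad f).
  by rewrite bb23_f bfun2_q bsec2_q !bb_lie_triE dgrad0 subr0.
have ssf e f : bfun2 (bsec3 s e) f = - pairing (Q e) (dgrad f).
  by rewrite bb23_sf !bfun2_q bsec2_q !bb_lie_triE rho0 subr0 sub0r.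
have sss e e' : bsec2 (bsec3 s e) e'
    = Q (dorfman e e') - dorfman e (Q e') - dorfman (Q e) e'.
  by rewrite bb23_ss !bsec2_q !bb_lie_triE -dorfmanC addrK.
clearbody s; apply: bbF3_ext => [f|e].
  by rewrite bb32_f bfun2_q bsec2_q !sf dgrad0 Q0 QQ subr0.
apply: bbF2_ext => [f|e'].
  rewrite bb32_sf sf !ssf !bfun2_q bsec2_q pQQ dgrad0.
  by rewrite pairing0r !oppr0 !addr0.
rewrite bb32_ss sf !sss !bsec2_q !bb_lie_triE.
rewrite tri_op_scale.
have -> : scst M (- 2) *: tri_op psi e e' = (- tri_op psi e e') *+ 2.
  have -> : scst M (- 2) = -1 - 1.
    by apply: smooth_fun_eq => x; rewrite -[RHS]/(-1 - 1) -opprD.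
  by rewrite scalerDl scaleN1r mulr2n.
have Qanti : dorfman (Q e') (Q e) = - dorfman (Q e) (Q e').
  by apply/eqP; rewrite -addr_eq0 dorfmanC pQQ dgrad0.
rewrite -sch -dorfmanC Qanti !QD !QN !QQ !dorfman0r.
rewrite sub0r !opprK !subr0 !opprD !opprK.
have rearrange (V : zmodType) (a b c d : V) :
    a + b + (- b - d) + (c - d + (c + a)) = (a + c - d) *+ 2.
  rewrite (addrA (a + b)) addrK mulr2n.
  by rewrite [LHS](AC (2*(2*2)) (((1*3)*2)*((6*5)*4))).
exact: rearrange.
Qed.
End Torsion.
End Inverse.

(** * Torsion of the endomorphisms S_i *)

Section SmxTorsion.
Variables (w : form2 A) (p : bivector A) (psi : trivector A).
Hypotheses (pK : cancel (flat w) (sharp p)) (wK : cancel (sharp p) (flat w)).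

Local Notation S := (Smx w p).

Lemma Smx1E e : (S e).1 = - sharp p e.2. Proof. by []. Qed.
Lemma Smx2E e : (S e).2 = flat w e.1. Proof. by []. Qed.

Lemma SmxD : {morph S : e e' / e + e'}.
Proof.
move=> e e'; apply: dbl_eq => [|Z]; rewrite !dblE !(Smx1E, Smx2E) !dblE.
  by rewrite sharpD opprD.
by rewrite flatD.
Qed.

Lemma SmxZ f e : S (f *: e) = f *: S e.
Proof.
apply: dbl_eq => [|Z]; rewrite !dblE !(Smx1E, Smx2E) !dblE.
  by rewrite linearZ /= scalerN.
by rewrite linearZ.
Qed.

Lemma SmxK e : S (S e) = - e.
Proof.
apply: dbl_eq => [|Z]; rewrite !dblE !(Smx1E, Smx2E).
  by rewrite pK.
by rewrite flatN wK.
Qed.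

Let B e e' := dorfman e e' + tri_op psi e e'.

Let BDl e1 e2 e3 : B (e1 + e2) e3 = B e1 e3 + B e2 e3.
Proof. by rewrite /B dorfmanDl tri_opDl addrACA. Qed.
Let BDr e1 e2 e3 : B e1 (e2 + e3) = B e1 e2 + B e1 e3.
Proof. by rewrite /B dorfmanDr tri_opDr addrACA. Qed.

Let fstE (T U : Type) (x : T) (y : U) : (x, y).1 = x. Proof. by []. Qed.
Let sndE (T U : Type) (x : T) (y : U) : (x, y).2 = y. Proof. by []. Qed.

(** S maps A into A^*, where the Dorfman bracket vanishes, so $[SX,SY]$ contributes [psi] alone; the
    other terms add up to the Cartan formula for $d\omega$. *)
Lemma Smx_torsion_sec1 X Y Z :
  flat w (torsion B S (X, 0) (Y, 0)).1 Z
  = dform2 mu w X Y Z + flat w Z (trisharp psi (flat w X) (flat w Y)).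
Proof.
have SX V : S (V, 0) = (0, flat w V) by rewrite /Smx sharp0 oppr0.
rewrite /torsion !SX !dblE Smx1E /B !(dorfman1E, tri_op1E, dblE, tri_op2E).
rewrite !addr0 trisharp0 oppr0 addr0 br0 add0r opprK.
rewrite !(flatD, flatN) wK !(dual_addE, dual_oppE) !dorfman2E.
rewrite !(fstE, sndE) (flatC w (trisharp _ _ _)) /dform2 -!flatE.
rewrite (flatC w (br X Z) Y) (flatC w (br Y Z) X).
by rewrite !(rho0l, br0l, dual_zeroE, dual0, rho0); ring.
Qed.

Lemma Smx_torsion_sec2 X Y : (torsion B S (X, 0) (Y, 0)).2 = 0.
Proof.
have SX V : S (V, 0) = (0, flat w V) by rewrite /Smx sharp0 oppr0.
apply: dual_eq => Z.
rewrite /torsion !SX !dblE Smx2E /B !(dorfman1E, tri_op1E, dblE, tri_op2E).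
rewrite !(fstE, sndE) (trisharpC psi 0) !trisharp0 br0 br0l !oppr0 !addr0.
rewrite flat0 oppr0 addr0.
rewrite dual_addE dual_oppE !dorfman2E !(fstE, sndE).
by rewrite !(rho0l, br0l, dual_zeroE, dual0, rho0); ring.
Qed.

Lemma Smx_torsionP : (forall e e', torsion B S e e' = 0) <-> integrability w psi.
Proof.
split=> [T0 X Y Z|dwE].
  apply/eqP; rewrite -addr_eq0 -Smx_torsion_sec1 T0.
  by rewrite linear0.
have T0 X Y : torsion B S (X, 0) (Y, 0) = 0.
  apply: dbl_eq => [|Z]; last by rewrite Smx_torsion_sec2.
  apply: (can_inj pK); apply: dual_eq => Z.
  by rewrite Smx_torsion_sec1 dwE addNr raddf0.
(* $A\oplus A^*=A+S(A)$, so the commutation of the torsion with S reduces everything to sections of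
   A. *)
have dec e : e = (e.1, 0) + S (sharp p e.2, 0).
  apply: dbl_eq => [|Z]; rewrite !dblE ?Smx1E ?Smx2E.
    by rewrite sharp0 oppr0 addr0.
  by rewrite add0r wK.
move=> e e'; rewrite (dec e) (dec e').
have S0 : S 0 = 0 by apply: (addrI (S 0)); rewrite -SmxD !addr0.
rewrite !(torsionDl BDl SmxD, torsionDr BDr SmxD).
rewrite !(torsionSl BDl SmxD SmxK, torsionSr BDr SmxD SmxK).
by rewrite !T0 !(S0, oppr0) !addr0.
Qed.

Lemma deform_SmxP (T := derived (bb_of_lie mu + bb_of_trivector psi)) :
  deform (deform T S) S = opp_bracket_anchor T <-> integrability w psi.
Proof.
rewrite -Smx_torsionP /T derivedE; split=> [H e e'|T0].
  (* The brackets differ by twice the torsion. In the converse direction the anchors agree already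
     because $S^2=-1$. *)
  have := congr1 (fun T => ca_bracket T e e') H.
  rewrite /= (deform_bracket BDl BDr SmxD SmxK).
  rewrite -[RHS]addr0 => /addrI t2; apply: (@mulr2n_inj _ _ M).
  by rewrite t2 mul0rn.
congr BracketAnchor; apply/funext => e; apply/funext => e'.
  by rewrite /= -[LHS]/(la_anchor mu (S (S e)).1 e') SmxK dbl_opp1 rhoNl.
by rewrite /= (deform_bracket BDl BDr SmxD SmxK) T0 mul0rn addr0.
Qed.
End SmxTorsion.
End LieAlgebroid.

(** * Index arithmetic in Z_3 *)

Lemma Z3_neq (i j : 'Z_3) : i != j ->
  exists k, (i = k - 1 /\ j = k + 1) \/ (i = k + 1 /\ j = k - 1).
Proof.
(* The third index: three distinct elements of Z_3 sum to zero. *)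
move=> ij; exists (- (i + j)); move: ij.
case: i => -[|[|[|i]]] //= Hi; case: j => -[|[|[|j]]] //= Hj _.
all: by [left; split; exact: val_inj | right; split; exact: val_inj].
Qed.

Lemma Z3_const (T : Type) (F : 'Z_3 -> T) :
  (forall k, F k = F (k - 1)) -> forall i j, F i = F j.
Proof.
move=> FS; suff F0 i : F i = F 0 by move=> i j; rewrite !F0.
case: i => -[|[|[|i]]] //= Hi; first by congr F; exact: val_inj.
  by rewrite FS; congr F; exact: val_inj.
by rewrite 2!FS; congr F; exact: val_inj.
Qed.

Lemma Z3_neqDB (k : 'Z_3) : [/\ k - 1 != k + 1, k != k - 1 & k != k + 1].
Proof. by case: k => -[|[|[|k]]]. Qed.

Lemma Z3_sub2 (k : 'Z_3) : k - 1 - 1 = k + 1.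
Proof. by case: k => -[|[|[|k]]] // Hk; exact: val_inj. Qed.

(** * Triplets *)

Section Quaternions.
Variables (R : realType) (n : nat) (M : manifold R n) (r : nat).
Variable A : vbundle M r.
Variables (omega : 'Z_3 -> form2 A) (p : 'Z_3 -> bivector A).
Hypotheses (pK : forall i, cancel (flat (omega i)) (sharp (p i))).
Hypotheses (wK : forall i, cancel (sharp (p i)) (flat (omega i))).
Local Notation N := (transition omega p).
Local Notation w i := (flat (omega i)).
Local Notation q i := (sharp (p i)).

(** $N_k=\pi_{k-1}^\sharp\omega_{k+1}^\flat$ has inverse $\pi_{k+1}^\sharp\omega_{k-1}^\flat$, so
    $N_k^2=-1$ says that $N_k$ is minus this inverse; every pair of distinct indices is such a pair
    k-1, k+1. *)
Lemma transition_sqrP :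
  (forall i X, N i (N i X) = - X) <->
  (forall i j X, i != j -> q i (w j X) = - q j (w i X)).
Proof.
split=> [NN i j X /Z3_neq[k]|anti i X].
  have key Y : q (k - 1) (w (k + 1) Y) = - q (k + 1) (w (k - 1) Y).
    have /(congr1 (fun Z => q (k + 1) (w (k - 1) Z))) := NN k Y.
    by rewrite /transition wK pK flatN sharpN.
  by case=> -[-> ->]; rewrite key ?opprK.
rewrite /transition (anti (i - 1) (i + 1) X); last by case: (Z3_neqDB i).
by rewrite flatN sharpN wK pK.
Qed.

Lemma flat_sharp_anticomm :
  (forall i j X, i != j -> q i (w j X) = - q j (w i X)) ->
  forall i j a, i != j -> w i (q j a) = - w j (q i a).
Proof.
move=> anti i j a ij; rewrite -[in LHS](wK i a) (anti j i); last by rewrite eq_sym.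
by rewrite flatN wK.
Qed.

(** $S_iS_j$ is block diagonal. The A-block is the stated relation, and the A^*-block is its
    conjugate, [flat_sharp_anticomm]. *)
Lemma Smx_anticommP :
  (forall i j X, i != j -> q i (w j X) = - q j (w i X)) <->
  (forall i j e, i != j -> Smx (omega i) (p i) (Smx (omega j) (p j) e)
    = - Smx (omega j) (p j) (Smx (omega i) (p i) e)).
Proof.
split=> [anti i j e ij|anti i j X ij].
  have ji : j != i by rewrite eq_sym.
  apply: dbl_eq => [|Z]; rewrite !dblE !(Smx1E, Smx2E).
    by rewrite anti // !opprK.
  by rewrite !(flatN, dual_oppE) flat_sharp_anticomm // dual_oppE.
have := congr1 (fun e => e.1) (anti i j (X, 0) ij).
by rewrite /= => /(congr1 -%R); rewrite !opprK.
Qed.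

(** For the next lemma, two exchanges give
    $\omega_k\pi_{k-1}\omega_{k+1}=-\omega_{k-1}\pi_k\omega_{k+1}=\omega_{k-1}\pi_{k+1}\omega_k$,
    and the last term is $\omega_{k-1}N_{k-1}$ because k-2 = k+1. *)
Hypothesis anti : forall i j X, i != j -> q i (w j X) = - q j (w i X).

Lemma metric_indep i j X : w i (N i X) = w j (N j X).
Proof.
apply: (Z3_const (F := fun k => w k (N k X))) => k.
have [k2 k1 _] := Z3_neqDB k.
rewrite /transition Z3_sub2 subrK flat_sharp_anticomm // anti ?flatN ?opprK //.
by case: (Z3_neqDB k).
Qed.

End Quaternions.

(** * Weak-Poisson and torsion conditions, and the equivalence *)

Section Main.
Variables (R : realType) (n : nat) (M : manifold R n) (r : nat).
Variables (A : vbundle M r) (mu : lie_algebroid A).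
Local Notation G := (gsection A).

(** The forms $\omega^\flat Z$ already separate sections when [flat w] is injective; this supplies
    the hypothesis of [courant_derivedP]. *)
Lemma dual_separates (w : form2 A) (p : bivector A) (X : G) :
  cancel (flat w) (sharp p) -> (forall a : dual G, a X = 0) -> X = 0.
Proof.
move=> pK aX0; apply: (can_inj pK); apply: dual_eq => Z.
by rewrite flatC aX0 flat0 oppr0.
Qed.

Lemma weak_poissonP (w : form2 A) (p : bivector A) (psi : trivector A) :
  cancel (flat w) (sharp p) -> cancel (sharp p) (flat w) ->
  integrability mu w psi ->
  weak_poisson mu p <-> courant (derived (bb_of_lie mu + bb_of_trivector psi)).
Proof.
move=> pK wK dw.
have sep X := @dual_separates w p X pK.
have two0 : - 2 != 0 :> R by rewrite oppr_eq0 Num.Theory.pnatr_eq0.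
rewrite /weak_poisson (bb_bivector_tri pK wK dw).
exact: iff_trans (bb_lie_tri_scaleP mu psi two0)
  (iff_sym (courant_derivedP mu psi sep)).
Qed.

Section Triplets.
Variables (omega : 'Z_3 -> form2 A) (p : 'Z_3 -> bivector A).
Hypotheses (pK : forall i, cancel (flat (omega i)) (sharp (p i))).
Hypotheses (wK : forall i, cancel (sharp (p i)) (flat (omega i))).
Local Notation N := (transition omega p).
Hypothesis NN : forall i X, N i (N i X) = - X.

(** Substitute $N_iX,N_iY,N_iZ$ in (1): $N_i$ is onto, with inverse $-N_i$, and by [metric_indep]
    the right-hand side can be written with index 0 for every i. *)
Lemma integrability_transition psi i :
  integrability mu (omega i) psi <->
  (forall X Y Z, dform2 mu (omega i) (N i X) (N i Y) (N i Z)
    = - flat (omega 0) (N 0 Z)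
         (trisharp psi (flat (omega 0) (N 0 X)) (flat (omega 0) (N 0 Y)))).
Proof.
have /(transition_sqrP pK wK) anti := NN.
have g X := metric_indep wK anti 0 i X.
split=> [dw X Y Z|dNw X Y Z]; first by rewrite !g dw.
have NK V : N i (- N i V) = V.
  by rewrite -[RHS]opprK -(NN i V) /transition flatN sharpN.
by have := dNw (- N i X) (- N i Y) (- N i Z); rewrite !g !NK.
Qed.
End Triplets.
End Main.

Theorem theorem9p4 (R : realType) (n : nat) (M : manifold R n) (r : nat)
    (A : vbundle M r) (mu : lie_algebroid A)
    (omega : 'Z_3 -> form2 A) (p : 'Z_3 -> bivector A) :
  (hypersymplectic_with_torsion mu omega p /\
   (forall i, inverse_of (omega i) (p i)) /\
   (forall i, weak_poisson mu (p i)))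
  <->
  (exists psi : trivector A,
     let Theta := derived (bb_of_lie mu + bb_of_trivector psi) in
     courant Theta /\ hypersymplectic Theta (fun i => Smx (omega i) (p i))).
Proof.
split=> [[[nondeg pK NN dNw] [_ wp]]|[psi [cou [_ _ SS SJ dS]]]].
  have wK i : cancel (sharp (p i)) (flat (omega i)).
    by apply/(bij_can_sym (nondeg i)); exact: pK.
  (* The trivector is read off from the form of index 0; equality of the $N_i d\omega_i$ carries (1)
     over to the other two. *)
  have dw i : integrability mu (omega i) (form_tri mu (omega 0) (p 0)).
    apply/(integrability_transition mu pK wK NN) => X Y Z; rewrite (dNw i 0).
    apply: (integrability_transition mu pK wK NN _ 0).1.
    exact: integrability_form_tri (pK 0) (wK 0).
  exists (form_tri mu (omega 0) (p 0)); split.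
    exact/(weak_poissonP (pK 0) (wK 0) (dw 0)).
  split=> [i f e e'|i e e'|i e|i j e|i].
  - by rewrite SmxD SmxZ.
  - rewrite /pairing !Smx1E !Smx2E !dualN flatC sharpC; ring.
  - exact: SmxK (pK i) (wK i) e.
  - by apply: (Smx_anticommP wK).1; apply/(transition_sqrP pK wK).
  - exact/(deform_SmxP _ _ (pK i) (wK i)).
(* The two diagonal blocks of $S_i^2=-1$ say that $\omega_i^\flat$ and $\pi_i^\sharp$ are mutually
   inverse. *)
have pK i : cancel (flat (omega i)) (sharp (p i)).
  move=> X; have := congr1 (fun e => - e.1) (SS i (X, 0)).
  by rewrite /= !opprK.
have wK i : cancel (sharp (p i)) (flat (omega i)).
  move=> a; have := congr1 (fun e => e.2) (SS i (0, a)).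
  rewrite Smx2E Smx1E flatN => /(congr1 -%R).
  by rewrite opprK => ->; rewrite opprK.
have NN : forall i X, transition omega p i (transition omega p i X) = - X.
  by apply/(transition_sqrP pK wK)/(Smx_anticommP wK).
have dw i : integrability mu (omega i) psi.
  exact/(deform_SmxP _ _ (pK i) (wK i)).
split; last by split=> // i; exact/(weak_poissonP (pK i) (wK i) (dw i)).
split=> // [i|i j X Y Z]; first by exists (sharp (p i)).
(* The right-hand side no longer depends on k. *)
have T k := (integrability_transition mu pK wK NN psi k).1 (dw k).
by rewrite !T.
Qed.
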